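(* Let $U$ be a nonempty open subset of $\mathbb{R}^d$, let $(x_n)_{n\ge1}$ be a sequence in $\mathbb{R}^d$ that is uniformly eutaxic in $U$, and let $\mathrm{r}=(r_n)_{n\ge1}$ be a nonincreasing sequence of positive reals. Let $F=\{x\in\mathbb{R}^d:|x-x_n|<r_n\text{ for infinitely many }n\ge1\}$. If $\sum_nr_n^d=\infty$, then $F$ has full Lebesgue measure in $U$. If $\sum_nr_n^d<\infty$, then $F$ is $\mathfrak{n}_{\mathrm{r}}$-describable in $U$, where $\mathfrak{n}_{\mathrm{r}}$ is the Borel measure on $(0,1]$ given by $\mathfrak{n}_{\mathrm{r}}=\sum_{n:\,r_n\le1}\delta_{r_n}$ (so $\int f\,d\mathfrak{n}_{\mathrm r}=\sum_n f(r_n)$ for nonnegative measurable $f$ supported in $(0,1]$).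
   Context: $\mathrm{P}_d$ is the set of real sequences $(r_n)_{n\ge1}$ with $r_{n+1}\le r_n$, $r_n\to0$ and $\sum_nr_n^d=\infty$; $(x_n)$ is uniformly eutaxic in $U$ if for every $(r_n)\in\mathrm{P}_d$, $\mathcal{L}^d$-a.e. $x\in U$ satisfies $|x-x_n|<r_n$ for infinitely many $n$. Fix $d\ge1$ and a norm $|\cdot|$ on $\mathbb{R}^d$ (diameters are taken with respect to it); $\mathcal{L}^d$ is Lebesgue measure. A gauge function is a function $g:[0,\infty]\to[0,\infty]$ that is nondecreasing on a neighbourhood of $0$ and satisfies $\lim_{r\to0}g(r)=g(0)=0$, $g(\infty)=\infty$; $\mathfrak{G}$ denotes the set of gauge functions. $\mathcal{H}^g$ is the Hausdorff $g$-measure: $\mathcal{H}^g(E)=\lim_{\delta\downarrow0}\inf\{\sum_ng(\mathrm{diam}\,C_n):E\subseteq\bigcup_nC_n,\ \mathrm{diam}\,C_n\le\delta\}$. The $d$-normalization of $g$ is $g_d(r)=r^d\inf_{0<\rho\le r}g(\rho)/\rho^d$ for $r\in(0,\infty)$, $g_d(0)=0$, $g_d(\infty)=\infty$; $g$ is $d$-normalized if $g=g_d$ on a neighbourhood of $0$. Let $\ell_g=\liminf_{r\to0}g(r)/r^d$, $\mathfrak{G}^\infty=\{g\in\mathfrak{G}:\ell_g=\infty\}$, $\mathfrak{G}^*=\{g\in\mathfrak{G}:\ell_g\in(0,\infty]\}$. For $d$-normalized gauge functions $g,h$ write $h\prec g$ if $h(r)/g(r)$ increases monotonically to $\infty$ as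 $r\downarrow0$ (with the convention that $h\prec g$ for every $h$ if $g$ vanishes on a neighbourhood of $0$). Dyadic cubes are the sets $2^{-j}(k+[0,1)^d)$, $j\in\mathbb{Z}$, $k\in\mathbb{Z}^d$. For a $d$-normalized gauge function $h$, let $\varepsilon_h$ be the supremum of those $\varepsilon>0$ such that $h$ is nondecreasing on $[0,\varepsilon]$ and $r\mapsto h(r)/r^d$ is nonincreasing on $(0,\varepsilon]$, and let $\mathcal{M}^h_\infty(E)=\inf\sum_nh(\mathrm{diam}\,\lambda_n)$, the infimum over all countable coverings of $E$ by dyadic cubes $\lambda_n$ of diameter less than $\varepsilon_h$. For a gauge function $g$ and a nonempty open set $U\subseteq\mathbb{R}^d$, the large intersection class $G^g(U)$ is the collection of $G_\delta$ subsets $F\subseteq\mathbb{R}^d$ such that $\mathcal{M}^h_\infty(F\cap V)=\mathcal{M}^h_\infty(V)$ for every $d$-normalized gauge function $h$ with $h\prec g_d$ and every open $V\subseteq U$. Let $\mathcal{Z}(U)$ be the set of Borel sets $E$ with $\mathcal{L}^d(E\cap U)=0$; for such $E$, the majorizing collection is $\mathfrak{M}(E,U)=\{g\in\mathfrak{G}^\infty:\mathcal{H}^g(E\cap U)=0\}$ and the minorizing collection is $\mathfrak{m}(E,U)=\{g\in\mathfrak{G}^*:\exists F\in G^g(U),\ F\subseteq E\}$. Let $\mathcal{R}$ be the set of positive Borel measures $\mathfrak{n}$ on $(0,1]$ with infinite total mass and $\mathfrak{n}([\rho,1])<\infty$ for all $\rho\in(0,1]$, and $\mathcal{R}_d=\{\mathfrak{n}\in\mathcal{R}:\int_{(0,1]}r^d\,\mathfrak{n}(dr)<\infty\}$.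 For $\mathfrak{n}\in\mathcal{R}_d$, $\mathfrak{G}(\mathfrak{n})=\{g\in\mathfrak{G}^\infty:\int_{(0,1]}g_d\,d\mathfrak{n}=\infty\}$ and $\mathfrak{G}(\mathfrak{n})^\complement=\mathfrak{G}^\infty\setminus\mathfrak{G}(\mathfrak{n})$. A set $E$ is $\mathfrak{n}$-describable in $U$ if $E\in\mathcal{Z}(U)$, $\mathfrak{M}(E,U)=\mathfrak{G}(\mathfrak{n})^\complement$ and $\mathfrak{m}(E,U)\cap\mathfrak{G}^\infty=\mathfrak{G}(\mathfrak{n})$. For $\mathfrak{s}\in[0,d)$, $\mathfrak{G}(\mathfrak{s})$ is the set of $g\in\mathfrak{G}^\infty$ such that for every $s>\mathfrak{s}$, $g_d(r)$ is not $o(r^s)$ as $r\to0$; $E$ is $\mathfrak{s}$-describable in $U$ if $E\in\mathcal{Z}(U)$, $\mathfrak{M}(E,U)=\mathfrak{G}^\infty\setminus\mathfrak{G}(\mathfrak{s})$ and $\mathfrak{m}(E,U)\cap\mathfrak{G}^\infty=\mathfrak{G}(\mathfrak{s})$. *)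

(* Defs.v *)
From HB Require Import structures.
From mathcomp Require Import all_boot all_order all_algebra.
From mathcomp Require Import all_classical all_reals all_analysis.
Set Implicit Arguments. Unset Strict Implicit. Unset Printing Implicit Defensive.
Import Order.TTheory GRing.Theory Num.Theory.
Import numFieldNormedType.Exports.
Local Open Scope classical_set_scope.
Local Open Scope ring_scope.

Section Defs.
Variables (R : realType) (d : nat).
Local Notation V := 'rV[R]_d.

Definition is_norm (nrm : V -> R) : Prop :=
  [/\ forall x, 0 <= nrm x,
      forall x, nrm x = 0 -> x = 0,
      forall (a : R) x, nrm (a *: x) = `|a| * nrm x &
      forall x y, nrm (x + y) <= nrm x + nrm y].

(** diameter w.r.t. nrm (diam set0 = 0) *)
Definition diam (nrm : V -> R) (C : set V) : \bar R :=
  ereal_sup (0%E |` [set z | exists x y, [/\ C x, C y & z = (nrm (x - y))%:E]]).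

Definition box (a b : V) : set V := [set x | forall i, a 0 i <= x 0 i < b 0 i].
Definition box_vol (a b : V) : R := \prod_(i < d) Num.max (b 0 i - a 0 i) 0.
Definition leb_outer (A : set V) : \bar R :=
  ereal_inf [set (\sum_(n <oo) (box_vol (ab.1 n) (ab.2 n))%:E)%E |
    ab in [set ab : (nat -> V) * (nat -> V) |
            A `<=` \bigcup_n box (ab.1 n) (ab.2 n)]].

Definition borel (E : set V) : Prop := <<s [set: V], open >> E.
Definition Gdelta (F : set V) : Prop :=
  exists O : nat -> set V, (forall n, open (O n)) /\ F = \bigcap_n O n.

(** gauge functions g : [0,oo] -> [0,oo] (values on negative arguments ignored) *)
Definition gauge (g : \bar R -> \bar R) : Prop :=
  [/\ forall x : \bar R, (0 <= x)%E -> (0 <= g x)%E,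
      exists2 e : R, 0 < e & forall x y : R, 0 <= x -> x <= y -> y <= e ->
                                             (g x%:E <= g y%:E)%E,
      (forall e : R, 0 < e -> exists2 del : R, 0 < del &
          forall r : R, 0 < r -> r < del -> (g r%:E < e%:E)%E),
      g 0%E = 0%E & g +oo%E = +oo%E].

Definition ell (g : \bar R -> \bar R) : \bar R :=
  ereal_sup [set ereal_inf [set (g r%:E * ((r ^+ d)^-1)%:E)%E | r in `]0%R, del[ ]
            | del in `]0, +oo[ ].

Definition Ginf : set (\bar R -> \bar R) := [set g | gauge g /\ ell g = +oo%E].
Definition Gstar : set (\bar R -> \bar R) := [set g | gauge g /\ (0 < ell g)%E].

Definition dnorm (g : \bar R -> \bar R) : \bar R -> \bar R := fun x =>
  match x with
  | EFin r => if r <= 0 then 0%E else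
      ((r ^+ d)%:E * ereal_inf [set (g rho%:E * ((rho ^+ d)^-1)%:E)%E | rho in `]0%R, r] ])%E
  | +oo%E => +oo%E
  | -oo%E => 0%E
  end.

Definition dnormalized (g : \bar R -> \bar R) : Prop :=
  exists2 e : R, 0 < e & forall r : R, 0 <= r -> r <= e -> g r%:E = dnorm g r%:E.

Definition eratio (a b : \bar R) : \bar R :=
  if b is EFin b' then (a * (b'^-1)%:E)%E else 0%E.

Definition prec (h g : \bar R -> \bar R) : Prop :=
  (exists2 e : R, 0 < e & forall r : R, 0 <= r -> r <= e -> g r%:E = 0%E) \/
  (exists2 e : R, 0 < e &
     (forall r s : R, 0 < r -> r <= s -> s <= e ->
        (eratio (h s%:E) (g s%:E) <= eratio (h r%:E) (g r%:E))%E) /\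
     (forall M : R, exists2 del : R, 0 < del & forall r : R, 0 < r -> r < del ->
        (M%:E < eratio (h r%:E) (g r%:E))%E)).

Definition hausdorff_delta (nrm : V -> R) (g : \bar R -> \bar R) (del : R) (E : set V)
  : \bar R :=
  ereal_inf [set (\sum_(n <oo) g (diam nrm (C n)))%E |
    C in [set C : nat -> set V | E `<=` \bigcup_n C n /\
                                 forall n, (diam nrm (C n) <= del%:E)%E]].
Definition hausdorff (nrm : V -> R) (g : \bar R -> \bar R) (E : set V) : \bar R :=
  ereal_sup [set hausdorff_delta nrm g del E | del in `]0, +oo[ ].

Definition dyadic (lam : set V) : Prop :=
  exists (j : int) (k : 'I_d -> int),
    lam = [set x | forall i, (k i)%:~R <= (2 : R) ^ j * x 0 i < (k i + 1)%:~R].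

Definition eps_h (h : \bar R -> \bar R) : \bar R :=
  ereal_sup [set e%:E | e in [set e : R | 0 < e /\
     (forall x y : R, 0 <= x -> x <= y -> y <= e -> (h x%:E <= h y%:E)%E) /\
     (forall r s : R, 0 < r -> r <= s -> s <= e ->
        (h s%:E * ((s ^+ d)^-1)%:E <= h r%:E * ((r ^+ d)^-1)%:E)%E)]].

(** M^h_oo: countable coverings by dyadic cubes of diameter < eps_h
    (a covering is a sequence whose terms are dyadic cubes or empty,
     so that finite coverings are included) *)
Definition Mh (nrm : V -> R) (h : \bar R -> \bar R) (E : set V) : \bar R :=
  ereal_inf [set (\sum_(n <oo) h (diam nrm (lam n)))%E |
    lam in [set lam : nat -> set V | E `<=` \bigcup_n lam n /\
       forall n, (lam n = set0 \/ dyadic (lam n)) /\ (diam nrm (lam n) < eps_h h)%E]].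

Definition large_int (nrm : V -> R) (g : \bar R -> \bar R) (U : set V) : set (set V) :=
  [set F | Gdelta F /\
    forall h, gauge h -> dnormalized h -> prec h (dnorm g) ->
    forall W : set V, open W -> W `<=` U -> Mh nrm h (F `&` W) = Mh nrm h W].

Definition Zset (U : set V) : set (set V) :=
  [set E | borel E /\ leb_outer (E `&` U) = 0%E].

Definition Maj (nrm : V -> R) (E U : set V) : set (\bar R -> \bar R) :=
  [set g | Ginf g /\ hausdorff nrm g (E `&` U) = 0%E].
Definition Min (nrm : V -> R) (E U : set V) : set (\bar R -> \bar R) :=
  [set g | Gstar g /\ exists2 F, large_int nrm g U F & F `<=` E].

(** G(n) for a Borel measure n on R (concentrated on (0,1]) *)
Definition Gn (n : {measure set R -> \bar R}) : set (\bar R -> \bar R) :=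
  [set g | Ginf g /\ (\int[n]_(r in `]0%R, 1%R]) dnorm g r%:E)%E = +oo%E].

Definition describable (nrm : V -> R) (n : {measure set R -> \bar R}) (E U : set V)
  : Prop :=
  [/\ Zset U E,
      Maj nrm E U = Ginf `\` Gn n &
      Min nrm E U `&` Ginf = Gn n].

Definition Pd (rr : nat -> R) : Prop :=
  [/\ forall n, rr n.+1 <= rr n, rr @ \oo --> 0 &
      (\sum_(n <oo) ((rr n) ^+ d)%:E)%E = +oo%E].

Definition io_ball (nrm : V -> R) (x : nat -> V) (rr : nat -> R) : set V :=
  [set y | forall N, exists2 n, (N <= n)%N & nrm (y - x n) < rr n].

Definition unif_eutaxic (nrm : V -> R) (x : nat -> V) (U : set V) : Prop :=
  forall rr, Pd rr -> leb_outer (U `\` io_ball nrm x rr) = 0%E.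

End Defs.

Definition nr_meas (R : realType) (r : nat -> R) : nat -> {measure set R -> \bar R} :=
  fun k => if r k <= 1 then (\d_(r k) : {measure set R -> \bar R}) else mzero.
Definition nr (R : realType) (r : nat -> R) : {measure set R -> \bar R} :=
  mseries (nr_meas r) 0.

(* Main.v *)
(** Both halves of describability rest on a mass transference argument carried out with dyadic
    cubes.  If [h] is a [d]-normalized gauge with [\sum_n h(r_n) = oo], eutaxy applied to the
    radii [R_n] with [R_n ^ d = h(r_n)] shows that almost every point of [U] is in infinitely many
    balls [B(x_n, R_n)].  Let dyadic cubes [mu_i] of finite total weight [\sum_i h(diam mu_i)]
    leave uncovered a set of positive measure in an open set.  Were all the small balls
    [B(x_n, r_n)] almost covered, the tail of the weights would control the measure of the
    uncovered set, which would then be null.  So some ball [B(x_n, r_n)] has an uncovered part of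
    positive measure; iterating and passing to a limit gives an uncovered point of [F].  If the
    uncovered part of a cube is null, monotonicity of [h(r) / r ^ d] bounds the weight below.
    Hence every dyadic cover of the trace of [F] on a cube has weight at least that of the cube,
    with constant one.  This gives both the large intersection property and [H^g(F) > 0].  In the
    convergence case the natural covers by balls give [H^g(F) = 0], and the gauge
    [\sum_k min(g_d, tau_k)], with [tau_k] decreasing fast, is still summable over the radii while
    dominating [g_d], which excludes [g] from the minorizing collection. *)
Require Import Defs.
From HB Require Import structures.
From mathcomp Require Import all_boot all_order all_algebra.
From mathcomp Require Import all_classical all_reals all_analysis.
From mathcomp Require Import measurable_realfun ring lra.
Set Implicit Arguments. Unset Strict Implicit. Unset Printing Implicit Defensive.
Import Order.TTheory GRing.Theory Num.Theory.
Import numFieldNormedType.Exports.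
Local Open Scope classical_set_scope.
Local Open Scope ring_scope.

(** Equality of contents tolerates no multiplicative loss, and this shapes the proof. Constants lost
    in passing from balls to cubes occur only where a set is to be shown null, and there they
    multiply an arbitrarily small tail. The weight comparison itself uses only the nesting of dyadic
    cubes, their exact measure and the fact that [r ^ d / h(r)] grows with [r], so it costs nothing.
    Only an outer measure is at hand. Everything rests on countable subadditivity and the exact
    value on cubes; inner approximation of an open set is done by a countable union, and cube
    boundaries, which form a null set, are discarded whenever a cube should be open. The bound
    [h(r) >= r ^ d] near [0] makes [R_n >= r_n], so that the cube fitted to [r_n] lies inside the
    one fitted to [R_n]. For [g_d] it comes from [ell g = +oo]; it passes to every [h] with
    [prec h g_d], because then [h >= g_d] near [0], which also transfers the divergence of the
    series. Summability of [r_n ^ d] forces [r_n -> 0], so conditions on gauges near [0] hold along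
    the radii from some index on. *)

Section series.
Variable R : realType.
Implicit Types (f : nat -> nat -> \bar R).
Local Open Scope ereal_scope.

Lemma nat_pair_bij : exists p : nat -> nat * nat, set_bij setT setT p.
Proof.
have /card_set_bijP [p bp] : ([set: nat] #= [set: nat * nat])%card.
  by rewrite card_eq_sym; exact: card_nat2.
by exists p.
Qed.

Lemma nneseries_esumT (u : nat -> \bar R) :
  (forall n, 0 <= u n) -> \sum_(n <oo) u n = \esum_(n in setT) u n.
Proof.
by move=> u0; rewrite nneseries_esum//; congr esum; apply/seteqP.
Qed.

Lemma nneseries_pair (p : nat -> nat * nat) f :
  set_bij setT setT p -> (forall a b, 0 <= f a b) ->
  \sum_(n <oo) f (p n).1 (p n).2 = \sum_(a <oo) \sum_(b <oo) f a b.
Proof.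
move=> bp f0.
transitivity (\esum_(k in [set: nat * nat]) f k.1 k.2).
  by rewrite (reindex_esum _ _ _ (fun k => f k.1 k.2) bp) nneseries_esumT.
transitivity (\esum_(i in [set: nat]) \esum_(j in [set: nat]) f i j).
  rewrite (@esum_esum _ _ _ setT (fun=> setT))//; congr esum.
  by apply/seteqP; split.
rewrite nneseries_esumT; last by move=> n; exact: nneseries_ge0.
by apply: eq_esum => i _; rewrite nneseries_esumT.
Qed.

Lemma nneseries_term (u : nat -> \bar R) (n : nat) :
  (forall i, 0 <= u i) -> u n <= \sum_(i <oo) u i.
Proof.
move=> u0.
apply: (@le_trans _ _ (\sum_(0 <= i < n.+1) u i)%R); last exact: nneseries_lim_ge.
by rewrite big_nat_recr//= leeDr// sume_ge0.
Qed.

Lemma nneseries_finite (u : nat -> \bar R) (n : nat) :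
  (forall i, 0 <= u i) -> (forall i, (n <= i)%N -> u i = 0) ->
  \sum_(i <oo) u i = (\sum_(i < n) u i)%R.
Proof.
move=> u0 un; rewrite (nneseries_split 0 n)// add0n eseries0 ?adde0 ?big_mkord//.
by move=> i ni _; exact: un.
Qed.

Lemma nneseries_head (c : \bar R) : 0 <= c ->
  \sum_(n <oo) (if n is 0%N then c else 0) = c.
Proof.
move=> c0; rewrite (@nneseries_finite _ 1); first by rewrite big_ord1.
  by case.
by case.
Qed.

Lemma nneseries_tail_lt (u : nat -> \bar R) (e : R) :
  (forall i, 0 <= u i) -> \sum_(i <oo) u i < +oo -> (0 < e)%R ->
  exists N, \sum_(N <= i <oo) u i < e%:E.
Proof.
move=> u0 ufin e0.
have /= := @nneseries_tail_cvg _ u xpredT ufin (fun k _ => u0 k).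
move=> /(_ [set y | y < e%:E]) [].
  by apply: open_nbhs_nbhs; split; [exact: open_ereal_lt_ereal|rewrite /= lte_fin].
by move=> N _ /(_ N (leqnn N)) /= h; exists N.
Qed.

End series.

(** * Lebesgue outer measure *)

Section lebesgue_outer.
Variables (R : realType) (d : nat).
Hypothesis d0 : (0 < d)%N.
Local Notation V := 'rV[R]_d.
Implicit Types (A B : set V) (a b : V).
Local Notation leb := (@leb_outer R d).

Lemma box_vol_ge0 a b : 0 <= box_vol a b.
Proof. by apply: prodr_ge0 => i _; rewrite le_max lexx orbT. Qed.

Lemma leb_outer_ge0 A : (0 <= leb A)%E.
Proof.
apply: le_ereal_inf_tmp => _ [ab _ <-]; apply: nneseries_ge0 => n _ _.
by rewrite lee_fin box_vol_ge0.
Qed.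

Lemma le_leb_outer A B : A `<=` B -> (leb A <= leb B)%E.
Proof.
by move=> AB; apply: ereal_inf_le_tmp => _ [ab Bab <-]; exists ab => //; apply: subset_trans Bab.
Qed.

Lemma leb_outer_box a b : (leb (box a b) <= (box_vol a b)%:E)%E.
Proof.
apply: ge_ereal_inf.
(* The padding box [box 0 0] has volume zero because [d > 0]; an empty product would be 1 and the
   series would diverge. *)
pose ab : (nat -> V) * (nat -> V) :=
  (fun n => if n is 0%N then a else 0, fun n => if n is 0%N then b else 0).
exists (\sum_(n <oo) (box_vol (ab.1 n) (ab.2 n))%:E)%E.
  by exists ab => // x xab; exists 0%N.
rewrite -[leRHS](nneseries_head (c := (box_vol a b)%:E)) ?lee_fin ?box_vol_ge0//.
apply: lee_nneseries => [n _ _|[|n] _//=]; first by rewrite lee_fin box_vol_ge0.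
rewrite lee_fin /box_vol (bigD1 (Ordinal d0))//= mxE subrr maxxx mul0r lexx//.
Qed.

Lemma leb_outer_bigcup (A : nat -> set V) :
  (leb (\bigcup_n A n) <= \sum_(n <oo) leb (A n))%E.
Proof.
apply/lee_addgt0Pr => e e0.
have [[n An]|Afin] := pselect (exists n, leb (A n) = +oo%E).
  suff -> : (\sum_(n <oo) leb (A n) = +oo)%E by rewrite addye// leey.
  apply/eqP; rewrite -leye_eq -An.
  exact: (nneseries_term n (fun i => leb_outer_ge0 (A i))).
have /choice [ab abP] n : exists ab : (nat -> V) * (nat -> V),
    A n `<=` \bigcup_m box (ab.1 m) (ab.2 m) /\
    (\sum_(m <oo) (box_vol (ab.1 m) (ab.2 m))%:E <= leb (A n) + (e / (2 ^ n.+1)%:R)%:E)%E.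
  have en : 0 < e / (2 ^ n.+1)%:R :> R by rewrite divr_gt0// ltr0n expn_gt0.
  have fA : leb (A n) \is a fin_num.
    rewrite ge0_fin_numE ?leb_outer_ge0// ltey; apply/eqP => An; apply: Afin; by exists n.
  have [_ [ab Aab <-]] := lb_ereal_inf_adherent en fA.
  by move=> /ltW ?; exists ab.
have [p bp] := nat_pair_bij.
apply: (@le_trans _ _ (\sum_(n <oo) \sum_(m <oo) (box_vol ((ab n).1 m) ((ab n).2 m))%:E)%E); last first.
  apply: le_trans (epsilon_trick _ (fun n => leb_outer_ge0 (A n)) (ltW e0)).
  apply: lee_nneseries => [n _ _|n _]; last exact: (abP n).2.
  by apply: nneseries_ge0 => m _ _; rewrite lee_fin box_vol_ge0.
apply: ge_ereal_inf.
exists (\sum_(n <oo) (box_vol ((ab (p n).1).1 (p n).2) ((ab (p n).1).2 (p n).2))%:E)%E.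
  exists (fun n => (ab (p n).1).1 (p n).2, fun n => (ab (p n).1).2 (p n).2) => //.
  move=> x [n _ Anx]; have [m _ xm] := (abP n).1 x Anx.
  have [_ _ /(_ (n, m) I) [k _ pk]] := bp.
  by exists k => //=; rewrite pk.
rewrite (nneseries_pair (f := fun n m => (box_vol ((ab n).1 m) ((ab n).2 m))%:E) bp)//.
by move=> n m; rewrite lee_fin box_vol_ge0.
Qed.

Lemma leb_outer_bigcup_eq0 (A : nat -> set V) :
  (forall n, leb (A n) = 0%E) -> leb (\bigcup_n A n) = 0%E.
Proof.
move=> A0; apply/eqP; rewrite eq_le leb_outer_ge0 andbT.
by apply: le_trans (leb_outer_bigcup A) _; rewrite eseries0.
Qed.

Lemma leb_outer_set0 : leb set0 = 0%E.
Proof.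
apply/eqP; rewrite eq_le leb_outer_ge0 andbT.
apply: le_trans (le_leb_outer (sub0set (box 0 0))) _.
apply: le_trans (leb_outer_box 0 0) _.
by rewrite lee_fin /box_vol (bigD1 (Ordinal d0))//= mxE subrr maxxx mul0r lexx.
Qed.

Lemma leb_outerU A B : (leb (A `|` B) <= leb A + leb B)%E.
Proof.
rewrite -bigcup2E; apply: le_trans (leb_outer_bigcup _) _.
rewrite (@nneseries_finite _ _ 2).
- by rewrite big_ord_recl big_ord1.
- by move=> i; exact: leb_outer_ge0.
- by move=> [|[|i]]//= _; exact: leb_outer_set0.
Qed.

Lemma leb_outerU_eq0 A B : leb A = 0%E -> leb B = 0%E -> leb (A `|` B) = 0%E.
Proof.
move=> A0 B0; apply/eqP; rewrite eq_le leb_outer_ge0 andbT.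
by apply: le_trans (leb_outerU A B) _; rewrite A0 B0 adde0.
Qed.

Lemma leb_outerS_eq0 A B : A `<=` B -> leb B = 0%E -> leb A = 0%E.
Proof.
by move=> AB B0; apply/eqP; rewrite eq_le leb_outer_ge0 andbT -B0 le_leb_outer.
Qed.

(** Countably many bounded slices, each inside a box that is arbitrarily thin in the direction
    [i]. *)
Lemma leb_outer_hyperplane (i : 'I_d) (c : R) : leb [set x : V | x 0 i = c] = 0%E.
Proof.
pose H n : set V := [set x | x 0 i = c /\ forall k, `|x 0 k| < n%:R].
apply: (@leb_outerS_eq0 _ (\bigcup_n H n)).
  move=> x xc; pose M := \sum_k `|x 0 k|.
  exists (Num.bound M) => //; split => // k.
  apply: (@le_lt_trans _ _ M).
    by rewrite /M (bigD1 k)//= lerDl sumr_ge0.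
  have M0 : 0 <= M by rewrite sumr_ge0.
  exact: archi_boundP.
apply: leb_outer_bigcup_eq0 => n; apply/eqP; rewrite eq_le leb_outer_ge0 andbT.
apply/lee_addgt0Pr => e e0; rewrite add0e.
(* The other [d.-1] sides have length [2 * n.+1], so this thickness makes the volume exactly [e]. *)
pose del : R := e / (2 * n.+1%:R) ^+ d.-1.
have del0 : 0 < del by rewrite divr_gt0// exprn_gt0// mulr_gt0.
pose a : V := \row_k if k == i then c else - n.+1%:R.
pose b : V := \row_k if k == i then c + del else n.+1%:R.
apply: (@le_trans _ _ (leb (box a b))).
  apply: le_leb_outer => x [xi xn] k; rewrite !mxE; case: eqP => [->|_].
    by rewrite xi lexx ltrDl.
  have := xn k; rewrite ltr_norml => /andP[h1 h2].
  have nn : n%:R <= n.+1%:R :> R by rewrite ler_nat.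
  by rewrite (le_trans _ (ltW h1)) ?lerN2//= (lt_le_trans h2).
apply: le_trans (leb_outer_box _ _) _.
rewrite lee_fin /box_vol (bigD1 i)//= !mxE eqxx addrAC subrr add0r.
rewrite (eq_bigr (fun=> 2 * n.+1%:R)); last first.
  move=> k ki; rewrite !mxE (negbTE ki) opprK.
  by rewrite max_l ?addr_ge0//; ring.
rewrite prodr_const cardC1 card_ord max_l ?(ltW del0)// divfK//.
Qed.


(** The indicator of [box a b] with the first [k] coordinates integrated out: integrating one more
    coordinate at a time compares a box with a countable cover by boxes. *)
Let mixed (k : nat) a b (x : V) : R :=
  \prod_(i < d) (if (i < k)%N then Num.max (b 0 i - a 0 i) 0
                 else (a 0 i <= x 0 i < b 0 i)%R%:R).
Let upd (x : V) (i : 'I_d) (t : R) : V := \row_j if j == i then t else x 0 j.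

Let mixed_ge0 k a b x : 0 <= mixed k a b x.
Proof. by apply: prodr_ge0 => i _; case: ifP => _; rewrite ?le_max ?lexx ?orbT. Qed.

Let mixed_upd a b x (i : 'I_d) : exists c : R, 0 <= c /\
  (forall t, mixed i a b (upd x i t) = c * \1_(`[a 0 i, b 0 i[) t) /\
  mixed i.+1 a b x = c * Num.max (b 0 i - a 0 i) 0.
Proof.
exists (\prod_(j < d | j != i) (if (j < i)%N then Num.max (b 0 j - a 0 j) 0
                 else (a 0 j <= x 0 j < b 0 j)%R%:R)); split.
  by apply: prodr_ge0 => j _; case: ifP => _; rewrite ?le_max ?lexx ?orbT.
split=> [t|]; rewrite /mixed (bigD1 i)//= mulrC; congr (_ * _).
- apply: eq_bigr => j ji; rewrite !mxE (negbTE ji)//.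
- by rewrite ltnn mxE eqxx indicE mem_setE in_itv.
- by apply: eq_bigr => j ji; rewrite ltnS leq_eqVlt -val_eqE in ji *; rewrite (negbTE ji).
- by rewrite ltnSn.
Qed.

Let integral_mixed a b x (i : 'I_d) :
  (\int[@lebesgue_measure R]_t (mixed i a b (upd x i t))%:E = (mixed i.+1 a b x)%:E)%E.
Proof.
have [c [c0 [ct ->]]] := mixed_upd a b x i.
under eq_integral do rewrite ct EFinM.
rewrite ge0_integralZl//; last first.
  by apply/measurable_EFinP; exact: measurable_indic.
rewrite integral_indic// setIT EFinM; congr (_ * _)%E.
have /= -> := lebesgue_measure_itv `[a 0 i, b 0 i[; rewrite lte_fin; case: ltP => ab; first by rewrite max_l ?subr_ge0 ?ltW.
by rewrite max_r// subr_le0.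
Qed.

Let measurable_mixed a b x (i : 'I_d) :
  measurable_fun setT (fun t : R => (mixed i a b (upd x i t))%:E).
Proof.
have [c [c0 [ct _]]] := mixed_upd a b x i.
apply/measurable_EFinP; rewrite (_ : (fun _ => _) = (fun t => c * \1_(`[a 0 i, b 0 i[) t)).
  by apply: measurable_funM => //; exact: measurable_indic.
by apply/funext => t; exact: ct.
Qed.

(** Induction on the number [k] of integrated coordinates, at every base point [x]. For [k = 0] the
    inequality says that the boxes cover; for [k = d] it compares volumes. Each step integrates one
    coordinate against one-dimensional Lebesgue measure and exchanges integral and series of
    nonnegative functions. *)
Lemma leb_outer_box_ge a b : ((box_vol a b)%:E <= leb (box a b))%E.
Proof.
apply: le_ereal_inf_tmp => _ [[A B] /= cov <-].
suff H k : (k <= d)%N -> forall x,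
    ((mixed k a b x)%:E <= \sum_(n <oo) (mixed k (A n) (B n) x)%:E)%E.
  have := H d (leqnn d) 0; congr (_ <= _)%E.
    by congr EFin; apply: eq_bigr => i _; rewrite ltn_ord.
  apply: eq_eseriesr => n _; congr EFin; apply: eq_bigr => i _; by rewrite ltn_ord.
elim: k => [|k IH] kd x.
  have [xab|xab] := pselect (box a b x); last first.
    rewrite [leLHS](_ : _ = 0%E); first by apply: nneseries_ge0 => n _ _; rewrite lee_fin.
    congr EFin; apply/eqP/negPn/negP => /prodf_neq0 h; apply: xab => i.
    by move: (h i isT) => /=; case: (_ <= _ < _)%R => //; rewrite eqxx.
  have [n _ xn] := cov _ xab.
  apply: (le_trans _ (nneseries_term n _)); last by move=> j; rewrite lee_fin.
  rewrite lee_fin /mixed !big1// => i _ /=; first by rewrite xn.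
  by rewrite xab.
pose i := Ordinal kd.
have := integral_mixed a b x i; rewrite /= => <-.
apply: (@le_trans _ _ (\int[@lebesgue_measure R]_t
    (\sum_(n <oo) (mixed i (A n) (B n) (upd x i t))%:E)))%E.
  apply: ge0_le_integral => //.
  - by move=> t _; rewrite lee_fin.
  - exact: measurable_mixed.
  - apply: (@ge0_emeasurable_sum _ _ _ _
      (fun n t => (mixed i (A n) (B n) (upd x i t))%:E) xpredT) => [n t _ _|n _].
      by rewrite lee_fin.
    exact: measurable_mixed.
  - by move=> t _; exact: IH (ltnW kd) _.
rewrite integral_nneseries//; last 2 first.
- by move=> n; exact: measurable_mixed.
- by move=> n t _; rewrite lee_fin.
by apply: lee_nneseries => [n _ _|n _]; rewrite (integral_mixed (A n) (B n) x i)// lee_fin.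
Qed.

End lebesgue_outer.

(** * Neighbourhoods of row vectors, described coordinatewise *)

Section coordinates.
Variables (R : realType) (d : nat).
Local Notation V := 'rV[R]_d.

Definition near_coord (e : R) (x y : V) := forall i, `|x 0 i - y 0 i| < e.

Lemma nbhs_coordP (x : V) (A : set V) :
  nbhs x A <-> exists2 e, 0 < e & near_coord e x `<=` A.
Proof.
split=> [/nbhs_ballP [e /= e0 eA]|[e e0 eA]].
  by exists e => // y xy; apply: eA; split => // i j; rewrite (ord1 i); exact: xy.
by apply/nbhs_ballP; exists e => // y /= [_ xy]; apply: eA => i; exact: xy.
Qed.

Lemma open_coordP (G : set V) :
  open G <-> forall x, G x -> exists2 e, 0 < e & near_coord e x `<=` G.
Proof.
rewrite openE; split => [oG x Gx|oG x Gx]; first exact/nbhs_coordP/oG.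
exact/nbhs_coordP/oG.
Qed.

Lemma near_coordC e (x y : V) : near_coord e x y -> near_coord e y x.
Proof. by move=> xy i; rewrite distrC. Qed.

Lemma near_coord_trans e f (x y z : V) :
  near_coord e x y -> near_coord f y z -> near_coord (e + f) x z.
Proof.
move=> xy yz i; rewrite -(subrKA (y 0 i)).
by apply: le_lt_trans (ler_normD _ _) _; rewrite ltrD.
Qed.

Lemma near_coord_open e (x : V) : open (near_coord e x).
Proof.
apply/open_coordP => y xy.
have [i0|noi] := pselect (exists i : 'I_d, True); last first.
  by exists 1 => // z _ i; case: noi; exists i.
case: i0 => i0 _.
pose m := [arg max_(i > i0) `|x 0 i - y 0 i|]%O.
have mP i : `|x 0 i - y 0 i| <= `|x 0 m - y 0 m|.
  by rewrite /m; case: arg_maxP => // k _; exact.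
exists (e - `|x 0 m - y 0 m|); first by rewrite subr_gt0.
move=> z yz i; rewrite -(subrKA (y 0 i)).
apply: le_lt_trans (ler_normD _ _) _.
rewrite -[ltRHS](subrK `|x 0 m - y 0 m|) addrC.
by rewrite ltr_leD.
Qed.

End coordinates.

(** * Equivalence of the norm with the sup norm *)

Section norms.
Variables (R : realType) (d : nat).
Hypothesis d0 : (0 < d)%N.
Local Notation V := 'rV[R]_d.
Variable nrm : V -> R.
Hypothesis hnrm : is_norm nrm.

Lemma nrm_ge0 v : 0 <= nrm v. Proof. by case: hnrm. Qed.
Lemma nrm_eq0 v : nrm v = 0 -> v = 0. Proof. by case: hnrm => _ + _ _; exact. Qed.
Lemma nrmZ a v : nrm (a *: v) = `|a| * nrm v. Proof. by case: hnrm. Qed.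
Lemma nrmD u v : nrm (u + v) <= nrm u + nrm v. Proof. by case: hnrm. Qed.
Lemma nrm0 : nrm 0 = 0.
Proof. by rewrite -(scale0r 0) nrmZ normr0 mul0r. Qed.
Lemma nrmB u v : nrm (u - v) = nrm (v - u).
Proof. by rewrite -opprB -scaleN1r nrmZ normrN1 mul1r. Qed.
Lemma nrm_sum (I : finType) (F : I -> V) : nrm (\sum_i F i) <= \sum_i nrm (F i).
Proof.
elim/big_ind2: _ => [|u a v b ua vb|//]; first by rewrite nrm0.
by apply: le_trans (nrmD _ _) _; rewrite lerD.
Qed.

Lemma nrm_le_coord : exists2 C, 0 < C &
  forall (v : V) e, (forall i, `|v 0 i| <= e) -> nrm v <= C * e.
Proof.
exists (1 + \sum_i nrm (delta_mx 0 i)).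
  by rewrite ltr_wpDr// sumr_ge0// => i _; exact: nrm_ge0.
move=> v e ve.
have e0 : 0 <= e by apply: le_trans (ve (Ordinal d0)).
rewrite [v in nrm v]row_sum_delta mulrDl mul1r.
apply: (le_trans (nrm_sum _)); apply: (@le_trans _ _ (\sum_i nrm (delta_mx 0 i) * e)).
  by apply: ler_sum => i _; rewrite nrmZ mulrC ler_wpM2l// nrm_ge0.
by rewrite mulr_suml lerDr.
Qed.

Lemma nrm_continuous : continuous nrm.
Proof.
have [C C0 HC] := nrm_le_coord.
move=> x A /nbhs_ballP [e /= e0 eA].
apply/nbhs_coordP; exists (e / C / 2); first by rewrite !divr_gt0.
move=> y xy; apply: eA; apply: (@le_lt_trans _ _ (nrm (x - y))).
  rewrite ler_norml; apply/andP; split.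
    rewrite lerBrDl lerBlDr nrmB -[X in nrm X <= _](subrK x) addrC; exact: nrmD.
  by rewrite lerBlDr -[X in nrm X <= _](subrK y); exact: nrmD.
apply: (@le_lt_trans _ _ (C * (e / C / 2))).
  by apply: HC => i; rewrite !mxE; apply/ltW/xy.
by rewrite mulrA mulrCA divff ?gt_eqF// mulr1 ltr_pdivrMr// ltr_pMr// ltr1n.
Qed.

(** The norm is continuous, hence has a positive minimum [m i] on the compact face where the
    coordinate [i] is 1 and all others are at most 1 in absolute value. Dividing [v] by its largest
    coordinate puts it on such a face. *)
Lemma nrm_ge_coord : exists2 C, 0 < C & forall (v : V) i, `|v 0 i| <= C * nrm v.
Proof.
have /choice [m mP] (i : 'I_d) : exists m, 0 < m /\
    forall v : V, (forall j, `|v 0 j| <= 1) -> v 0 i = 1 -> m <= nrm v.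
  pose A (j : 'I_d) : set R := if j == i then [set 1] else `[-1, 1]%classic.
  pose K : set V := [set v | forall j, A j (v ord0 j)].
  have cK : compact K.
    apply: rV_compact => j; rewrite /A; case: ifP => _; first exact: compact_set1.
    exact: segment_compact.
  have K0 : K !=set0.
    exists (\row_j (j == i)%:R) => j; rewrite /A mxE; case: eqP => //= _.
    by rewrite in_itv/= lerN10 ler01.
  have [|c Kc cmin] := EVT_min_rV K0 cK (f := nrm).
    by apply: continuous_subspaceT => z; exact: nrm_continuous.
  have ci : c 0 i = 1 by move: Kc; rewrite inE => /(_ i); rewrite /A eqxx.
  exists (nrm c); split.
    rewrite lt_neqAle nrm_ge0 andbT eq_sym; apply/eqP => /nrm_eq0 c0.
    by move: ci; rewrite c0 mxE => /esym/eqP; rewrite oner_eq0.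
  move=> v v1 vi; apply: cmin; rewrite inE => j; rewrite /A; case: eqP => [->//|_].
  by rewrite /= in_itv/= -ler_norml.
(* The sum serves as a bound common to all faces, since it dominates each [(m i)^-1]. *)
exists (\sum_i (m i)^-1).
  rewrite (bigD1 (Ordinal d0))//= ltr_pwDl// ?invr_gt0 ?(mP _).1//.
  by apply: sumr_ge0 => i _; rewrite invr_ge0 ltW// (mP _).1.
move=> v j.
pose i := [arg max_(k > j) `|v 0 k|]%O.
have iP k : `|v 0 k| <= `|v 0 i| by rewrite /i; case: arg_maxP => // l _; exact.
have [vi0|vi0] := eqVneq (v 0 i) 0.
  have := iP j; rewrite vi0 normr0 => /le_trans; apply.
  by rewrite mulr_ge0 ?nrm_ge0// sumr_ge0// => k _; rewrite invr_ge0 ltW// (mP _).1.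
have mi := (mP i).1.
apply: (le_trans (iP j)).
have : m i <= nrm ((v 0 i)^-1 *: v).
  apply: (mP i).2 => [k|]; rewrite !mxE ?mulVf//.
  by rewrite normrM normfV mulrC ler_pdivrMr ?mul1r ?normr_gt0.
rewrite nrmZ normfV mulrC ler_pdivlMr ?normr_gt0// mulrC -ler_pdivlMr// mulrC.
move=> /le_trans; apply; apply: ler_wpM2r; first exact: nrm_ge0.
rewrite (bigD1 i)//= lerDl sumr_ge0// => k _; rewrite invr_ge0 ltW// (mP _).1//.
Qed.

Lemma nrm_ball_open (x : V) (r : R) : open [set y | nrm (y - x) < r].
Proof.
have [C C0 HC] := nrm_le_coord.
apply/open_coordP => y /= yr.
exists ((r - nrm (y - x)) / C / 2); first by rewrite !divr_gt0// subr_gt0.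
move=> z yz /=.
rewrite -(subrKA y); apply: (le_lt_trans (nrmD _ _)); rewrite -ltrBrDr.
apply: (@le_lt_trans _ _ (C * ((r - nrm (y - x)) / C / 2))).
  by apply: HC => i; rewrite !mxE distrC; apply/ltW/yz.
rewrite mulrA mulrCA divff ?gt_eqF// mulr1 ltr_pdivrMr// ltr_pMr ?ltr1n//.
by rewrite subr_gt0.
Qed.

End norms.

(** * Dyadic cubes *)

Section cubes.
Variables (R : realType) (d : nat).
Hypothesis d0 : (0 < d)%N.
Local Notation V := 'rV[R]_d.
Implicit Types (j : int) (x y : V).

(** The dyadic cube of side [2 ^ (- j)] through [x], encoded as a class of equal floors: every point
    names its own cube, and equality and nesting of cubes become facts on floors. *)
Definition cell j x : set V :=
  [set y | forall i, Num.floor ((2 : R) ^ j * y 0 i) = Num.floor (2 ^ j * x 0 i)].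

Lemma pow2_gt0 j : 0 < (2 : R) ^ j. Proof. by rewrite exprz_gt0. Qed.
Lemma pow2_neq0 j : (2 : R) ^ j != 0. Proof. by rewrite gt_eqF// pow2_gt0. Qed.

Lemma pow2V j : (2 : R) ^ (- j) * 2 ^ j = 1.
Proof. by rewrite -expfzDr// addNr expr0z. Qed.

Lemma pow2S j : (2 : R) ^ (- (j + 1)) = 2 ^ (- j) / 2.
Proof. by rewrite opprD expfzDr. Qed.

Lemma ler_pow2 j j' : ((2 : R) ^ (- j) <= 2 ^ (- j')) = (j' <= j).
Proof. by rewrite ler_eXz2l ?ltr1n// lerN2. Qed.

Lemma ltr_pow2 j j' : ((2 : R) ^ (- j) < 2 ^ (- j')) = (j' < j).
Proof. by rewrite ltr_eXz2l ?ltr1n// ltrN2. Qed.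

Lemma mem_cell j x : cell j x x. Proof. by []. Qed.

Lemma cell_eq j x y : cell j x y -> cell j y = cell j x.
Proof.
by move=> xy; apply/seteqP; split => z /= h i; rewrite h; [exact: xy|exact/esym/xy].
Qed.

Lemma dyadic_cell j x : dyadic (cell j x).
Proof.
exists j, (fun i => Num.floor (2 ^ j * x 0 i)); apply/seteqP; split => y /= h i.
  by rewrite -h floor_itv.
exact: floor_def.
Qed.

Lemma dyadicP (L : set V) x : dyadic L -> L x -> exists j, L = cell j x.
Proof.
move=> [j [k ->]] /= xL; exists j; apply/seteqP; split => y /= h i.
  by rewrite (floor_def (h i)) (floor_def (xL i)).
by rewrite -(floor_def (xL i)) -h floor_itv.
Qed.

Lemma dyadic_neq0 (L : set V) : dyadic L -> L !=set0.
Proof.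
move=> [j [k ->]]; exists (\row_i ((k i)%:~R / 2 ^ j)) => i /=.
by rewrite mxE mulrC divfK ?pow2_neq0// lexx ltr_int ltrDl.
Qed.

Lemma dyadicE (L : set V) : dyadic L -> exists j x, L = cell j x.
Proof.
by move=> dL; have [x Lx] := dyadic_neq0 dL; have [j ->] := dyadicP dL Lx; exists j, x.
Qed.

(** The integer [2 ^+ n * floor a] lies below [2 ^+ n * a], hence below its floor. This is the
    source of the nesting of dyadic cubes. *)
Lemma floor_pow2 (n : nat) (u v : R) :
  Num.floor (2 ^+ n * u) = Num.floor (2 ^+ n * v) -> Num.floor u = Num.floor v.
Proof.
have H (a b : R) : Num.floor (2 ^+ n * a) = Num.floor (2 ^+ n * b) ->
    Num.floor a <= Num.floor b.
  move=> ab; rewrite floor_ge_int -(@ler_pM2l _ (2 ^+ n)) ?exprn_gt0//.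
  have -> : (2 : R) ^+ n * (Num.floor a)%:~R = ((2 ^+ n) * Num.floor a)%:~R.
    by rewrite rmorphM rmorphXn.
  by rewrite -floor_ge_int -ab floor_ge_int rmorphM rmorphXn/= ler_pM2l ?exprn_gt0// floor_le.
by move=> uv; apply/eqP; rewrite eq_le !H.
Qed.

Lemma cell_sub j j' x : j <= j' -> cell j' x `<=` cell j x.
Proof.
rewrite -subr_ge0 => jj y /= h i; apply: (@floor_pow2 `|j' - j|%N).
have e : (2 : R) ^+ `|j' - j|%N * 2 ^ j = 2 ^ j'.
  by rewrite exprnP -expfzDr// gez0_abs// subrK.
by rewrite !mulrA e.
Qed.

Lemma cell_coord j x y z (i : 'I_d) : cell j x y -> cell j x z ->
  `|y 0 i - z 0 i| < 2 ^ (- j).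
Proof.
move=> xy xz; rewrite -(@ltr_pM2l _ (2 ^ j)) ?pow2_gt0// [ltRHS]mulrC pow2V.
rewrite -[X in X * _]gtr0_norm ?pow2_gt0// -normrM mulrBr.
have /andP[a1 a2] := floor_itv (2 ^ j * y 0 i).
have /andP[b1 b2] := floor_itv (2 ^ j * z 0 i).
rewrite xz -(xy i) rmorphD/= in b1 b2; rewrite rmorphD/= in a2.
by rewrite ltr_norml; lra.
Qed.

Lemma cell_box j x : exists a b, cell j x = box a b /\ box_vol a b = (2 ^ (- j)) ^+ d.
Proof.
exists (\row_i ((Num.floor (2 ^ j * x 0 i))%:~R * 2 ^ (- j))).
exists (\row_i ((Num.floor (2 ^ j * x 0 i) + 1)%:~R * 2 ^ (- j))); split; last first.
  rewrite /box_vol (eq_bigr (fun=> 2 ^ (- j))); first by rewrite prodr_const card_ord.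
  move=> i _; rewrite !mxE -mulrBl -rmorphB/= addrAC subrr add0r mul1r.
  by rewrite max_l ?ltW ?pow2_gt0.
rewrite -invr_expz; apply/seteqP; split => y /= h i; have := h i; rewrite !mxE.
  move=> <-; rewrite ler_pdivrMr ?ltr_pdivlMr ?pow2_gt0// mulrC.
  exact: floor_itv.
by rewrite ler_pdivrMr ?ltr_pdivlMr ?pow2_gt0// [y 0 i * _]mulrC => h'; exact: floor_def.
Qed.

Lemma leb_outer_cell j x : leb_outer (cell j x) = ((2 ^ (- j)) ^+ d)%:E.
Proof.
have [a [b [-> <-]]] := cell_box j x.
by apply/eqP; rewrite eq_le leb_outer_box ?leb_outer_box_ge.
Qed.

Definition dil (c : R) j x : set V := [set y | forall i, `|y 0 i - x 0 i| <= c * 2 ^ (- j)].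

Lemma leb_outer_dil c j x : 0 <= c ->
  (leb_outer (dil c j x) <= ((2 * c + 1) ^+ d * (2 ^ (- j)) ^+ d)%:E)%E.
Proof.
(* [dil] is closed and boxes are half-open, so one more length [2 ^ (- j)] is added on the right;
   this is the 1 in [2 * c + 1]. *)
move=> c0; pose a : V := \row_i (x 0 i - c * 2 ^ (- j)).
pose b : V := \row_i (x 0 i + (c + 1) * 2 ^ (- j)).
have p0 := pow2_gt0 (- j).
apply: (@le_trans _ _ (leb_outer (box a b))).
  apply: le_leb_outer => y /= xy i; rewrite !mxE; have := xy i.
  by rewrite ler_norml; lra.
apply: le_trans (leb_outer_box d0 _ _) _.
rewrite lee_fin /box_vol -exprMn (eq_bigr (fun=> (2 * c + 1) * 2 ^ (- j))).
  by rewrite prodr_const card_ord.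
by move=> i _; rewrite !mxE max_l; [ring|nra].
Qed.

(** Off the null set [grid], cells are neighbourhoods of their points. *)
Definition grid : set V :=
  [set y | exists (j : int) (i : 'I_d), (Num.floor (2 ^ j * y 0 i))%:~R = 2 ^ j * y 0 i].

(** There is one hyperplane for each level, integer and coordinate; [unpickle] enumerates these
    triples. *)
Lemma leb_outer_grid : leb_outer grid = 0%E.
Proof.
pose H (m : int * int * 'I_d) : set V := [set y | y 0 m.2 = m.1.2%:~R / 2 ^ m.1.1].
pose A n := if unpickle n is Some m then H m else set0.
apply: (@leb_outerS_eq0 _ _ _ (\bigcup_n A n)).
  move=> y [j [i h]]; pose m := (j, Num.floor (2 ^ j * y 0 i), i).
  exists (pickle m); [exact: I|rewrite /A (pickleK m)].
  by rewrite /H /m /= h mulrC mulKf// pow2_neq0.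
apply: leb_outer_bigcup_eq0 => n; rewrite /A; case: unpickle => [m|].
  exact: leb_outer_hyperplane.
exact: leb_outer_set0.
Qed.

Lemma cell_nbhs j y : ~ grid y -> exists2 e, 0 < e & near_coord e y `<=` cell j y.
Proof.
move=> gy; pose u i := 2 ^ j * y 0 i.
have uf i : (Num.floor (u i))%:~R < u i.
  rewrite lt_neqAle floor_le andbT; apply/eqP => h; apply: gy; by exists j, i.
have uc i : u i < (Num.floor (u i) + 1)%:~R by have /andP[] := floor_itv (u i).
pose e i := Num.min (u i - (Num.floor (u i))%:~R) ((Num.floor (u i) + 1)%:~R - u i).
have e0 i : 0 < e i by rewrite lt_min !subr_gt0 uf uc.
pose i0 := Ordinal d0.
pose m := [arg min_(i < i0) e i]%O.
have mP i : e m <= e i by rewrite /m; case: arg_minP => // k _; exact.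
exists (2 ^ (- j) * e m); first by rewrite mulr_gt0 ?pow2_gt0.
move=> z yz i; apply: floor_def.
have : `|u i - 2 ^ j * z 0 i| < e i.
  apply: lt_le_trans (mP i); rewrite -mulrBr normrM gtr0_norm ?pow2_gt0//.
  by rewrite -(@ltr_pM2l _ (2 ^ (- j))) ?pow2_gt0// mulrA pow2V mul1r.
by rewrite lt_min => /andP[]; rewrite !ltr_norml => /andP[? ?] /andP[? ?]; apply/andP; split; lra.
Qed.

Lemma cell_compl_nbhs j x y : ~ grid y -> ~ cell j x y ->
  exists2 e, 0 < e & near_coord e y `<=` ~` cell j x.
Proof.
move=> gy xy; have [e e0 ey] := cell_nbhs j gy; exists e => // z /ey yz xz.
by apply: xy; rewrite -(cell_eq xz) (cell_eq yz).
Qed.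

Section diameter.
Variable nrm : V -> R.
Hypothesis hnrm : is_norm nrm.

Lemma diam_ge0 (C : set V) : (0 <= diam nrm C)%E.
Proof. by apply: ereal_sup_ubound; left. Qed.

Lemma diam_ge (C : set V) x y : C x -> C y -> ((nrm (x - y))%:E <= diam nrm C)%E.
Proof. by move=> Cx Cy; apply: ereal_sup_ubound; right; exists x, y. Qed.

Lemma diam_le (C : set V) (M : \bar R) : (0 <= M)%E ->
  (forall x y, C x -> C y -> ((nrm (x - y))%:E <= M)%E) -> (diam nrm C <= M)%E.
Proof.
move=> M0 CM; apply: ge_ereal_sup => _ [->//|[x [y [Cx Cy ->]]]]; exact: CM.
Qed.

Lemma diam_set0 : diam nrm set0 = 0%E.
Proof. by apply/eqP; rewrite eq_le diam_ge0 andbT; exact: diam_le. Qed.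

Definition cube_diam : R := fine (diam nrm (cell 0 0)).

Lemma diam_unit : diam nrm (cell 0 0) = cube_diam%:E.
Proof.
have [C C0 HC] := nrm_le_coord d0 hnrm.
rewrite fineK// ge0_fin_numE ?diam_ge0//; apply: (@le_lt_trans _ _ (C * 1)%:E); last exact: ltry.
apply: diam_le => [|x y x0 y0]; first by rewrite lee_fin mulr1 ltW.
rewrite lee_fin; apply: HC => i; rewrite !mxE; have := cell_coord i x0 y0.
by rewrite oppr0 expr0z => /ltW.
Qed.

Lemma cube_diam_gt0 : 0 < cube_diam.
Proof.
pose v : V := \row_(i < d) 2^-1.
have [C C0 HC] := nrm_ge_coord d0 hnrm.
have : ((nrm v)%:E <= diam nrm (cell 0 0))%E.
  rewrite -[v]subr0; apply: diam_ge => // i; rewrite !mxE expr0z !mul1r.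
  by rewrite floor0; apply: floor_def; rewrite add0r; apply/andP; split; lra.
rewrite diam_unit lee_fin; apply: lt_le_trans.
have := HC v (Ordinal d0); rewrite mxE gtr0_norm ?invr_gt0// => h.
by rewrite -(@pmulr_rgt0 _ C)//; apply: lt_le_trans h; rewrite invr_gt0.
Qed.

(** All dyadic cubes are half-open in the same way, so each is an exact dilated translate of the
    unit cube, and both inequalities follow by transporting pairs of points. *)
Lemma diam_cell j x : diam nrm (cell j x) = (cube_diam * 2 ^ (- j))%:E.
Proof.
have D0 := cube_diam_gt0.
(* The integer corner for which [y] maps to [2 ^ j *: y - k] sends [cell j x] onto [cell 0 0]. *)
pose k : V := \row_i (Num.floor (2 ^ j * x 0 i))%:~R.
have floork (y : V) (i : 'I_d) : Num.floor ((2 ^ j *: y - k) 0 i) =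
    Num.floor (2 ^ j * y 0 i) - Num.floor (2 ^ j * x 0 i).
  rewrite !mxE; apply: floor_def; have := floor_itv (2 ^ j * y 0 i).
  by rewrite !rmorphD/= !rmorphN/= => /andP[? ?]; apply/andP; split; lra.
have ub : (diam nrm (cell j x) <= (cube_diam * 2 ^ (- j))%:E)%E.
  apply: diam_le => [|y z xy xz]; first by rewrite lee_fin mulr_ge0 ?ltW ?pow2_gt0.
  rewrite mulrC EFinM -diam_unit.
  have -> : y - z = 2 ^ (- j) *: ((2 ^ j *: y - k) - (2 ^ j *: z - k)).
    by rewrite opprB addrA subrK -scalerBr scalerA pow2V scale1r.
  rewrite nrmZ// gtr0_norm ?pow2_gt0// EFinM lee_pmul2l ?lte_fin ?pow2_gt0//.
  by apply: diam_ge => i; rewrite !expr0z !mul1r floork ?xy ?xz subrr [in RHS]mxE floor0.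
apply/eqP; rewrite eq_le ub/=.
have fd : diam nrm (cell j x) \is a fin_num.
  by rewrite ge0_fin_numE ?diam_ge0//; apply: le_lt_trans ub _; exact: ltry.
suff : (cube_diam%:E <= (2 ^ j)%:E * diam nrm (cell j x))%E.
  rewrite -(fineK fd) -EFinM !lee_fin => h.
  by rewrite -invr_expz ler_pdivrMr ?pow2_gt0// mulrC.
rewrite -diam_unit; apply: diam_le => [|y z y0 z0].
  by rewrite mule_ge0 ?diam_ge0// lee_fin ltW ?pow2_gt0.
have -> : y - z = 2 ^ j *: (2 ^ (- j) *: (y + k) - 2 ^ (- j) *: (z + k)).
  rewrite -scalerBr scalerA mulrC pow2V scale1r; apply/rowP => i; rewrite !mxE; ring.
rewrite nrmZ// gtr0_norm ?pow2_gt0// EFinM lee_pmul2l ?lte_fin ?pow2_gt0//.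
have H (w : V) : cell 0 0 w -> cell j x (2 ^ (- j) *: (w + k)).
  move=> w0 i; have := w0 i; rewrite !mxE mulr0 floor0 expr0z mul1r mulrA.
  rewrite [2 ^ j * 2 ^ (- j)]mulrC pow2V mul1r => h; apply: floor_def.
  have := floor_itv (w 0 i); rewrite h; move: (Num.floor (2 ^ j * x 0 i)) => m.
  by rewrite !rmorphD/= => /andP[? ?]; apply/andP; split; lra.
by apply: diam_ge; exact: H.
Qed.

End diameter.
End cubes.

(** * Charging a disjoint family to the members of a cover *)

Section grouping.
Variables (R : realType) (T : Type).
Local Open Scope ereal_scope.

Definition inside (mu : nat -> set T) (B : set T) (n : nat) := mu n !=set0 /\ mu n `<=` B.

(** Each member of the disjoint family [Q] is charged to the least index [n] with [mu n] inside it. *)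
Lemma grouping (mu : nat -> set T) (Q : set (set T)) (v : set T -> \bar R) (a : nat -> \bar R) :
  (forall n, 0 <= a n) -> v set0 = 0 ->
  (forall B, Q B -> 0 < v B /\ v B <= \sum_(n <oo) (if `[< inside mu B n >] then a n else 0)) ->
  (forall B B', Q B -> Q B' -> B `&` B' !=set0 -> B = B') ->
  exists lam : nat -> set T,
    [/\ forall n, lam n = set0 \/ Q (lam n) /\ inside mu (lam n) n,
        forall B, Q B -> exists n, lam n = B &
        \sum_(n <oo) v (lam n) <= \sum_(n <oo) a n].
Proof.
move=> a0 v0 vQ disjQ.
(* Storing the charged set at the very index it is charged to keeps the relation
   [inside mu (lam n) n], which later allows [mu n] to be replaced by [lam n] in place. *)
pose first B n := [/\ Q B, inside mu B n & forall m, (m < n)%N -> ~ inside mu B m].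
have /choice [lam lamP] n : exists B, first B n \/ B = set0 /\ ~ exists B', first B' n.
  by have [[B hB]|h] := pselect (exists B, first B n); [exists B; left|exists set0; right].
have firstU B n m : first B n -> first B m -> n = m.
  move=> [_ n1 n2] [_ m1 m2]; case: (ltngtP n m) => // h; first by case: (m2 _ h).
  by case: (n2 _ h).
have lam_first B n : first B n -> lam n = B.
  move=> fB; case: (lamP n) => [[QL [_ nL] _]|[_ []]]; last by exists B.
  case: fB => QB [mn nB] _.
  apply: disjQ => //; have [z mz] := mn; exists z; split; [exact: nL|exact: nB].
exists lam; split.
- by move=> n; case: (lamP n) => [[? ? _]|[-> _]]; [right|left].
- move=> B QB.
  have [|noB] := pselect (exists n, inside mu B n).
    move=> h; have h' : exists n, `[< inside mu B n >] by case: h => n ?; exists n; apply/asboolP.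
    exists (ex_minn h'); apply: lam_first; case: ex_minnP => n /asboolP nB nmin; split => // m mn mB.
    by move: mn; rewrite ltnNge nmin//; apply/asboolP.
  (* A set with nothing inside it would have value at most 0, against [0 < v B]; positivity is what
     guarantees an index to charge. *)
  have [vB] := vQ _ QB; rewrite eseries0 ?leNgt ?vB// => n _ _.
  by case: asboolP => // nB; case: noB; exists n.
(* Disjointness of [Q] makes the index sets [K n] disjoint, so the sums over them add up to at most
   the whole series. *)
- pose K n : set nat := [set k | first (lam n) n /\ inside mu (lam n) k].
  have vK n : v (lam n) <= \esum_(k in K n) a k.
    case: (lamP n) => [fn|[-> _]]; last by rewrite v0; apply: esum_ge0.
    apply: le_trans (vQ _ _).2 _; first by case: fn.
    rewrite nneseries_esumT; last by move=> k; case: ifP.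
    rewrite [leRHS]esum_mkcond; apply: le_esum => k _; case: asboolP => h.
      by rewrite mem_set//; split.
    by case: ifP.
  rewrite nneseries_esumT; last first.
    move=> n; case: (lamP n) => [[/vQ[/ltW]]|[-> _]]//; by rewrite v0.
  apply: (@le_trans _ _ (\esum_(n in setT) \esum_(k in K n) a k)); first exact: le_esum.
  rewrite -esum_bigcupT//; last first.
    move=> n m _ _ [k [[fn kn] [fm km]]]; apply: (firstU (lam n)) => //.
    have -> // : lam n = lam m.
    apply: disjQ; [by case: fn|by case: fm|].
    by have [[z kz] kn'] := kn; exists z; split; [exact: kn'|exact: km.2].
  rewrite nneseries_esumT//.
  rewrite [leLHS]esum_mkcond; apply: le_esum => k _.
  by case: ifP.
Qed.

End grouping.

(** * Maximal dyadic cubes with a given property *)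

Section maximal_cells.
Variables (R : realType) (d : nat).
Local Notation V := 'rV[R]_d.
Variables (P : set V -> Prop) (J : int).

(** The coarsest admissible generation [J] bounds the size of the cubes, so that every admissible
    cube is contained in a maximal one; the least natural number [n] plays the role of
    maximality. *)
Definition max_cell : set (set V) := [set B | exists (n : nat) y,
  [/\ B = cell (J + n%:Z) y, P B & forall m, (m < n)%N -> ~ P (cell (J + m%:Z) y)]].

Lemma max_cell_disj B B' : max_cell B -> max_cell B' -> B `&` B' !=set0 -> B = B'.
Proof.
move=> [n [y [-> Pn nmin]]] [n' [y' [-> Pn' nmin']]] [z [yz y'z]].
have key m k (u : V) : cell (J + k%:Z) u z -> (m < k)%N -> cell (J + m%:Z) u = cell (J + m%:Z) z.
  move=> uz mk; apply/esym/cell_eq; apply: cell_sub uz.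
  by rewrite lerD2l lez_nat ltnW.
rewrite -(cell_eq yz) -(cell_eq y'z) in Pn Pn' *.
case: (ltngtP n n') => [nn'|n'n|->//].
- by case: (nmin' n nn'); rewrite (key _ _ _ y'z nn').
- by case: (nmin n' n'n); rewrite (key _ _ _ yz n'n).
Qed.

Lemma max_cell_exists j y : J <= j -> P (cell j y) ->
  exists2 B, max_cell B & cell j y `<=` B.
Proof.
rewrite -subr_ge0 => Jj Pj.
have h : exists n : nat, `[< P (cell (J + n%:Z) y) >].
  by exists `|j - J|%N; apply/asboolP; rewrite gez0_abs// subrKC.
exists (cell (J + (ex_minn h)%:Z) y).
  exists (ex_minn h), y; case: ex_minnP => n /asboolP Pn nmin; split => // m mn Pm.
  by move: mn; rewrite ltnNge nmin//; apply/asboolP.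
case: ex_minnP => n _ nmin; apply: cell_sub.
have : (n <= `|j - J|)%N by apply: nmin; apply/asboolP; rewrite gez0_abs// subrKC.
by rewrite -lez_nat gez0_abs// lerBrDl.
Qed.

End maximal_cells.

(** * Measure against gauge weight on dyadic cubes *)

Section mass.
Variables (R : realType) (d : nat).
Hypothesis d0 : (0 < d)%N.
Local Notation V := 'rV[R]_d.
Variable nrm : V -> R.
Hypothesis hnrm : is_norm nrm.
Local Notation D := (@cube_diam R d nrm).
Local Notation leb := (@leb_outer R d).

Definition dyadic0 (L : set V) := L = set0 \/ dyadic L.
Definition rdiam (L : set V) : R := fine (diam nrm L).

Lemma rdiam_cell j x : rdiam (cell j x) = D * 2 ^ (- j).
Proof. by rewrite /rdiam diam_cell. Qed.

Lemma rdiam_set0 : rdiam set0 = 0.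
Proof. by rewrite /rdiam diam_set0. Qed.

Lemma diam_rdiam L : dyadic0 L -> diam nrm L = (rdiam L)%:E.
Proof.
move=> [->|/dyadicE [j [x ->]]]; first by rewrite rdiam_set0 diam_set0.
by rewrite rdiam_cell diam_cell.
Qed.

Lemma rdiam_gt0 L : dyadic L -> 0 < rdiam L.
Proof.
by move=> /dyadicE [j [x ->]]; rewrite rdiam_cell mulr_gt0 ?pow2_gt0 ?cube_diam_gt0.
Qed.

Lemma rdiam_ge0 L : dyadic0 L -> 0 <= rdiam L.
Proof. by move=> [->|/rdiam_gt0/ltW//]; rewrite rdiam_set0. Qed.

Lemma le_rdiam L L' : dyadic0 L -> dyadic0 L' -> L `<=` L' -> rdiam L <= rdiam L'.
Proof.
move=> dL dL' LL'; rewrite -lee_fin -!diam_rdiam//.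
apply: diam_le => [|x y Lx Ly]; first exact: diam_ge0.
by apply: diam_ge; exact: LL'.
Qed.

Lemma leb_outer_dyadic L : dyadic0 L -> leb L = ((rdiam L / D) ^+ d)%:E.
Proof.
move=> [->|/dyadicE [j [x ->]]].
  by rewrite leb_outer_set0// rdiam_set0 mul0r expr0n eqn0Ngt d0.
by rewrite leb_outer_cell// rdiam_cell mulrC mulKf// gt_eqF// cube_diam_gt0.
Qed.

Lemma dyadic_nested (L L' : set V) z : dyadic L -> dyadic L' -> L z -> L' z ->
  L `<=` L' \/ L' `<=` L.
Proof.
move=> dL dL' Lz L'z; have [j ->] := dyadicP dL Lz; have [j' ->] := dyadicP dL' L'z.
by case: (leP j j') => [|/ltW] h; [right|left]; exact: cell_sub.
Qed.

Lemma dyadic_scale (r : R) : 0 < r -> exists j : int, D * 2 ^ (- j) < r <= 2 * (D * 2 ^ (- j)).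
Proof.
move=> r0; have D0 := cube_diam_gt0 d0 hnrm.
have P2 (y : R) : 0 < y -> exists n : nat, y < 2 ^+ n.
  move=> y0; exists (Num.bound y); apply: lt_le_trans (archi_boundP (ltW y0)) _.
  by rewrite -natrX ler_nat ltnW// ltn_expl.
have [m hm] := P2 (r / D) (divr_gt0 r0 D0).
have [k hk] := P2 (D / r) (divr_gt0 D0 r0).
(* Generations are shifted by [m] so that the search runs over natural numbers: [p] fails at [0] by
   the choice of [m] and holds at [m + k] by the choice of [k]. Failure one step before the minimum
   gives the factor 2. *)
pose p n := D * 2 ^ (- (n%:Z - m%:Z)) < r.
have ex : exists n, p n.
  exists (m + k)%N; rewrite /p PoszD addrC addKr -invr_expz ltr_pdivrMr ?pow2_gt0// mulrC.
  by rewrite -ltr_pdivrMr.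
exists ((ex_minn ex)%:Z - m%:Z); case: ex_minnP => -[|n] pn nmin.
  exfalso; move: pn; rewrite /p sub0r opprK -exprnP ltNge => /negP; apply.
  by rewrite mulrC -ler_pdivrMr// ltW.
apply/andP; split; first exact: pn.
have : ~~ p n by apply/negP => /nmin; rewrite ltnn.
rewrite /p -leNgt => /le_trans; apply.
by rewrite intS [1 + _]addrC addrAC pow2S mulrCA [2 * _]mulrC divfK.
Qed.

Variables (phi : R -> R) (e0 : R).

(** The local real-valued form of a [d]-normalized gauge that dominates [r ^+ d]. The monotonicity
    of [phi r / r ^+ d] is cross-multiplied, which avoids divisions. *)
Record scale_fun : Prop := ScaleFun {
  sf_e0 : 0 < e0;
  sf_0 : phi 0 = 0;
  sf_mono : forall r s, 0 <= r -> r <= s -> s <= e0 -> phi r <= phi s;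
  sf_ratio : forall r s, 0 < r -> r <= s -> s <= e0 -> phi s * r ^+ d <= phi r * s ^+ d;
  sf_ge : forall r, 0 <= r -> r <= e0 -> r ^+ d <= phi r }.

Hypothesis hphi : scale_fun.

Lemma sf_gt0 r : 0 < r -> r <= e0 -> 0 < phi r.
Proof.
by move=> r0 re; apply: lt_le_trans (sf_ge hphi (ltW r0) re); rewrite exprn_gt0.
Qed.

Lemma sf_ge0 r : 0 <= r -> r <= e0 -> 0 <= phi r.
Proof.
by move=> r0 re; apply: le_trans (sf_ge hphi r0 re); rewrite exprn_ge0.
Qed.

Definition wt (L : set V) : R := phi (rdiam L).

Definition small (L : set V) := dyadic0 L /\ rdiam L <= e0.

Lemma wt_ge0 L : small L -> 0 <= wt L.
Proof. by move=> [dL Le]; rewrite sf_ge0 ?rdiam_ge0. Qed.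

Lemma wt_set0 : wt set0 = 0.
Proof. by rewrite /wt rdiam_set0 (sf_0 hphi). Qed.

Lemma leb_le_wt L : small L -> (leb L <= ((D ^+ d)^-1 * wt L)%:E)%E.
Proof.
move=> [dL Le]; rewrite leb_outer_dyadic// lee_fin expr_div_n mulrC.
apply: ler_wpM2l; first by rewrite invr_ge0 exprn_ge0// ltW// cube_diam_gt0.
exact: (sf_ge hphi (rdiam_ge0 dL) Le).
Qed.

(** A cube [mu n] that meets [L] without containing it lies inside [L], so these cubes carry the
    whole measure of [L]. The ratio of measure to weight does not decrease with the diameter by
    [sf_ratio], hence is at most that of [L]; dividing by it leaves constant one. *)
Lemma mass (mu : nat -> set V) (L : set V) :
  (forall n, dyadic0 (mu n)) -> dyadic L -> rdiam L <= e0 ->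
  leb (L `\` \bigcup_n mu n) = 0%E -> (forall n, ~ L `<=` mu n) ->
  ((wt L)%:E <= \sum_(n <oo) (if `[< inside mu L n >] then (wt (mu n))%:E else 0))%E.
Proof.
move=> dmu dL Le Lnull Lmu.
have D0 := cube_diam_gt0 d0 hnrm.
have rL0 := rdiam_gt0 dL.
have wL0 : 0 < wt L by rewrite sf_gt0.
(* The ratio of measure to weight for [L] itself. *)
pose c : R := (rdiam L / D) ^+ d / wt L.
have c0 : 0 < c by rewrite divr_gt0// exprn_gt0// divr_gt0.
pose A n := if `[< inside mu L n >] then mu n else set0.
have smA n : inside mu L n -> small (mu n).
  move=> [_ nL]; split => //; apply: le_trans Le; apply: le_rdiam => //; by right.
have H : (leb L <= \sum_(n <oo) leb (A n))%E.
  apply: (@le_trans _ _ (leb ((L `\` \bigcup_n mu n) `|` \bigcup_n A n))).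
    apply: le_leb_outer => x Lx.
    have [[n _ nx]|] := pselect ((\bigcup_n mu n) x); last by left; split.
    right; exists n => //; rewrite /A; case: asboolP => // h; case: h.
    case: (dmu n) => [n0|dn]; first by move: nx; rewrite n0.
    split; first by exists x.
    by case: (dyadic_nested dL dn Lx nx) => // /Lmu.
  apply: le_trans (leb_outerU d0 _ _) _; rewrite Lnull add0e.
  exact: leb_outer_bigcup.
have : (leb L <= c%:E * \sum_(n <oo) (if `[< inside mu L n >] then (wt (mu n))%:E else 0))%E.
  apply: le_trans H _; rewrite -nneseriesZl; last first.
    by move=> n _; case: asboolP => // h; rewrite lee_fin wt_ge0//; exact: smA.
  apply: lee_nneseries => [n _ _|n _]; first exact: leb_outer_ge0.
  rewrite /A; case: asboolP => h; last by rewrite leb_outer_set0// mule0.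
  rewrite leb_outer_dyadic// -EFinM lee_fin /c.
  have dn : dyadic (mu n) by case: (dmu n) => // n0; case: h => -[z]; rewrite n0.
  have rn0 := rdiam_gt0 dn.
  rewrite mulrAC ler_pdivlMr// !expr_div_n mulrAC [leRHS]mulrAC.
  rewrite ler_pM2r ?invr_gt0 ?exprn_gt0// mulrC [leRHS]mulrC.
  apply: (sf_ratio hphi) => //; apply: le_rdiam => //; [by right|by case: h].
have -> : leb L = (c * wt L)%:E.
  by rewrite leb_outer_dyadic; [rewrite /c divfK// gt_eqF|right].
by rewrite EFinM lee_pmul2l ?lte_fin.
Qed.

Definition dl (c : R) (L : set V) : set V :=
  [set z | exists2 y, L y & forall i, `|z 0 i - y 0 i| <= c * rdiam L].

Lemma le_dl c L L' : 0 <= c -> dyadic0 L -> dyadic0 L' -> L `<=` L' -> dl c L `<=` dl c L'.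
Proof.
move=> c0 dL dL' LL' z [y Ly zy]; exists y; first exact: LL'.
by move=> i; apply: (le_trans (zy i)); rewrite ler_wpM2l// le_rdiam.
Qed.

Lemma leb_dl c L : 0 <= c -> dyadic0 L ->
  (leb (dl c L) <= ((2 * (c * D + 1) + 1) ^+ d)%:E * leb L)%E.
Proof.
move=> c0 [->|/dyadicE [j [x ->]]].
  rewrite (_ : dl c set0 = set0) ?leb_outer_set0 ?mule0//.
  by apply/seteqP; split => // z [].
have D0 := cube_diam_gt0 d0 hnrm.
(* The summand 1 accounts for moving from an arbitrary point of the cube to its base point [x]. *)
apply: (@le_trans _ _ (leb (dil (c * D + 1) j x))).
  apply: le_leb_outer => z [y xy zy] i; rewrite -(subrKA (y 0 i)).
  apply: le_trans (ler_normD _ _) _; rewrite mulrDl lerD//.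
    by have := zy i; rewrite rdiam_cell mulrA.
  by rewrite mul1r ltW// (@cell_coord _ _ j x).
by apply: le_trans (leb_outer_dil d0 _ _ _) _; rewrite ?leb_outer_cell// addr_ge0// mulr_ge0// ltW.
Qed.

End mass.

(** * Mass transference *)

Section ubiquity.
Variables (R : realType) (d : nat).
Hypothesis d0 : (0 < d)%N.
Local Notation V := 'rV[R]_d.
Variable nrm : V -> R.
Hypothesis hnrm : is_norm nrm.
Local Notation D := (@cube_diam R d nrm).
Local Notation leb := (@leb_outer R d).
Local Notation rdiam := (@rdiam R d nrm).
Local Notation dl := (@dl R d nrm).
Variables (phi : R -> R) (e0 : R).
Hypothesis hphi : scale_fun d phi e0.
Local Notation wt := (@wt R d nrm phi).
Local Notation small := (@small R d nrm e0).

Variables (U : set V) (x : nat -> V) (r rr : nat -> R) (N0 : nat).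
Hypothesis r_small : forall n, (N0 <= n)%N -> 0 < r n <= e0.
Hypothesis rr_ge0 : forall n, 0 <= rr n.
Hypothesis rr_phi : forall n, (N0 <= n)%N -> rr n ^+ d = phi (r n).
Hypothesis rr_cvg : forall e, 0 < e -> exists N, forall n, (N <= n)%N -> rr n < e.
Hypothesis rr_full : leb (U `\` io_ball nrm x rr) = 0%E.

Lemma le_pow_inv (a b : R) : 0 <= b -> a ^+ d <= b ^+ d -> a <= b.
Proof.
move=> b0 ab; rewrite leNgt; apply/negP => ba.
have a0 : 0 <= a := le_trans b0 (ltW ba).
by move: ab; rewrite leNgt ltr_pXn2r ?nnegrE// ba.
Qed.

Lemma r_le_rr n : (N0 <= n)%N -> r n <= rr n.
Proof.
move=> Nn; have /andP[rn0 rne] := r_small Nn.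
by apply: le_pow_inv; rewrite ?rr_ge0// rr_phi// (sf_ge hphi)// ltW.
Qed.

(** Off the grid, the complement of a cube not containing [a] is a neighbourhood of [a]; only
    finitely many such conditions are intersected. *)
Lemma avoid_nbhs (mu : nat -> set V) (a : V) (G : set V) K :
  (forall n, dyadic0 (mu n)) -> open G -> G a -> ~ grid a -> ~ (\bigcup_n mu n) a ->
  exists2 e, 0 < e & near_coord e a `<=` [set z | G z /\ forall k, (k < K)%N -> ~ mu k z].
Proof.
move=> dmu oG Ga ga ma; apply/nbhs_coordP.
elim: K => [|K IH].
  apply: (@filterS _ _ _ G); first by move=> z Gz; split.
  exact: open_nbhs_nbhs.
have nK : nbhs a (~` mu K).
  case: (dmu K) => [->|/dyadicE [j [y muE]]]; first by rewrite setC0; exact: filterT.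
  apply/nbhs_coordP; rewrite muE; apply: cell_compl_nbhs => // aj.
  by apply: ma; exists K => //; rewrite muE.
apply: filterS (filterI IH nK) => z [[Gz zk] zK]; split => // k.
by rewrite ltnS leq_eqVlt => /orP[/eqP ->//|]; exact: zk.
Qed.

(** [rr n] is comparable to the diameter of the large cell [cell J (x n)], while the small cell
    [cell j (x n)] lies in the ball of radius [r n]. *)
Lemma scales n : (N0 <= n)%N -> exists J j : int,
  [/\ J <= j, D * 2 ^ (- J) < rr n, rr n <= 2 * (D * 2 ^ (- J)),
      D * 2 ^ (- j) < r n & (D * 2 ^ (- J)) ^+ d <= 2 ^+ d * phi (D * 2 ^ (- j))].
Proof.
move=> Nn; have /andP[rn0 rne] := r_small Nn.
have D0 := cube_diam_gt0 d0 hnrm.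
have rrn0 : 0 < rr n := lt_le_trans rn0 (r_le_rr Nn).
have [J /andP[J1 J2]] := dyadic_scale d0 hnrm rrn0.
have [j /andP[j1 j2]] := dyadic_scale d0 hnrm rn0.
have c0 : 0 < D * 2 ^ (- j) by rewrite mulr_gt0 ?pow2_gt0.
have C0 : 0 < D * 2 ^ (- J) by rewrite mulr_gt0 ?pow2_gt0.
exists J, j; split => //.
  (* If [j < J], the large diameter is at most half the small one, so [rr n <= D * 2 ^ (- j) < r n],
     against [r_le_rr]. *)
  rewrite leNgt; apply/negP => jJ.
  have : (2 : R) ^ (- J) <= 2 ^ (- j) / 2 by rewrite -pow2S ler_pow2 -ltzD1 ltrD2r.
  rewrite ler_pdivlMr// -(ler_pM2l D0) => h.
  have := r_le_rr Nn; lra.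
(* Here [phi (r n)] equals [rr n ^+ d]; passing from [r n] down to a diameter at least half as large
   costs at most [2 ^+ d] by [sf_ratio]. *)
apply: (@le_trans _ _ (phi (r n))).
  by rewrite -rr_phi// lerXn2r ?nnegrE ?(ltW C0) ?(ltW rrn0) ?(ltW J1).
have := sf_ratio hphi c0 (ltW j1) rne.
rewrite -ler_pdivlMr ?exprn_gt0// => /le_trans; apply.
rewrite -mulrA mulrC ler_wpM2r//.
  exact: (sf_ge0 hphi) (ltW c0) (le_trans (ltW j1) rne).
have q : r n / (D * 2 ^ (- j)) <= 2 by rewrite ler_pdivrMr.
by rewrite -expr_div_n lerXn2r ?nnegrE// divr_ge0 ?(ltW rn0) ?(ltW c0).
Qed.

(** If every small cell [cell j (x n)] inside [G] is essentially covered by the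
    [mu k], then the larger cells [cell J (x n)] of measure about [phi (r n)] either lie in some
    [mu k] or carry weight comparable to their measure; the latter can be charged to a tail of
    the convergent series of weights. *)
Lemma uncovered_cell (G : set V) (mu : nat -> set V) (N : nat) :
  open G -> G `<=` U -> (forall n, small (mu n)) ->
  (\sum_(n <oo) (wt (mu n))%:E < +oo)%E ->
  leb (G `\` \bigcup_n mu n) != 0%E ->
  exists n j, [/\ (N <= n)%N, D * 2 ^ (- j) < r n, cell j (x n) `<=` G &
                  leb (cell j (x n) `\` \bigcup_n mu n) != 0%E].
Proof.
move=> oG GU smu muwt; apply: contra_neqP => noc.
have null n j : (N <= n)%N -> D * 2 ^ (- j) < r n -> cell j (x n) `<=` G ->
    leb (cell j (x n) `\` \bigcup_n mu n) = 0%E.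
  by move=> Nn jr jG; apply/eqP/negPn/negP => h; apply: noc; exists n, j.
have dmu n : dyadic0 (mu n) by case: (smu n).
have wmu n : 0 <= wt (mu n) by apply: (wt_ge0 d0 hnrm hphi).
have D0 := cube_diam_gt0 d0 hnrm.
have [c1 c10 Hc1] := nrm_ge_coord d0 hnrm.
(* [c1] bounds coordinates by the norm, and [rr n] is at most twice the diameter of the large cell,
   so dilation by [c] captures the ball of radius [rr n]. *)
pose c := 2 * c1; have c0 : 0 <= c by rewrite mulr_ge0// ltW.
pose Kc := (2 * (c * D + 1) + 1) ^+ d.
have Kc0 : 0 <= Kc by rewrite exprn_ge0// addr_ge0// mulr_ge0// addr_ge0// mulr_ge0// ltW.
(* [C] bounds the measure of the large cell by [phi] of the diameter of the small one; [C'] collects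
   all losses of the covering below. *)
pose C := 2 ^+ d / D ^+ d; have C0 : 0 < C by rewrite divr_gt0// exprn_gt0.
pose C' := Kc * ((D ^+ d)^-1 + C).
have C'0 : 0 <= C' by rewrite mulr_ge0// addr_ge0 ?invr_ge0 ?exprn_ge0// ltW.
apply/eqP; rewrite eq_le leb_outer_ge0 andbT; apply/lee_addgt0Pr => e ee0; rewrite add0e.
(* The final bound is [C' * (e / (C' + 1))]; the added 1 keeps the divisor positive. *)
have [K Ktail] : exists K, (\sum_(K <= n <oo) (wt (mu n))%:E < (e / (C' + 1))%:E)%E.
  apply: nneseries_tail_lt => //; last by rewrite divr_gt0// ltr_wpDl.
pose a n : \bar R := if (K <= n)%N then (wt (mu n))%:E else 0%E.
have a0 n : (0 <= a n)%E by rewrite /a; case: ifP => // _; rewrite lee_fin.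
have suma : (\sum_(n <oo) a n < (e / (C' + 1))%:E)%E.
  by rewrite -eseries_mkcond -ereal_series.
pose heavy (B : set V) : Prop := (leb B <= \sum_(n <oo)
  (if `[< inside mu B n >] then C%:E * a n else 0))%E.
pose Q := max_cell heavy 0.
have Qd B : Q B -> dyadic B by move=> [n [y [-> _ _]]]; exact: dyadic_cell.
have [lam [lamQ Qlam lamsum]] : exists lam : nat -> set V,
    [/\ forall n, lam n = set0 \/ Q (lam n) /\ inside mu (lam n) n,
        forall B, Q B -> exists n, lam n = B &
        (\sum_(n <oo) leb (lam n) <= \sum_(n <oo) C%:E * a n)%E].
  apply: grouping.
  - by move=> n; rewrite mule_ge0// lee_fin ltW.
  - exact: leb_outer_set0.
  - move=> B QB; split; last by case: QB => [n [y [_ hB _]]].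
    rewrite (leb_outer_dyadic d0 hnrm); last by right; exact: Qd.
    by rewrite lte_fin exprn_gt0// divr_gt0// (rdiam_gt0 d0 hnrm)//; exact: Qd.
  - exact: max_cell_disj.
have dlam n : dyadic0 (lam n) by case: (lamQ n) => [->|[/Qd ? _]]; [left|right].
(* Outside null sets, an uncovered point lies in a dilate of a tail cube or of a maximal heavy cell;
   both families have small total measure. *)
pose T n := (if (K <= n)%N then dl c (mu n) else set0) `|` dl c (lam n).
have cov : G `\` \bigcup_n mu n `<=` (U `\` io_ball nrm x rr) `|` (@grid R d `|` \bigcup_n T n).
  move=> z [Gz zmu].
  have [zio|zio] := pselect (io_ball nrm x rr z); last by left; split => //; exact: GU.
  right; have [gz|gz] := pselect (grid z); [by left|right].
  have [del del0 Hdel] := avoid_nbhs K dmu oG Gz gz zmu.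
  (* The first bound keeps the large cell within [del] of [z], hence in [G] and away from the first
     [K] cubes; the second makes its generation nonnegative, as [Q] requires. *)
  pose eta := Num.min (del / (c1 + D^-1)) D.
  have cD : 0 < c1 + D^-1 by rewrite addr_gt0// invr_gt0.
  have eta0 : 0 < eta by rewrite lt_min D0 divr_gt0.
  have [N1 HN1] := rr_cvg eta0.
  have [n] := zio (maxn N (maxn N0 N1)); rewrite !geq_max => /and3P[Nn N0n N1n] zn.
  have [J [j [Jj J1 J2 j1 wj]]] := scales N0n.
  have /andP[rn0 rne] := r_small N0n.
  have rrn := HN1 n N1n.
  have J0 : 0 <= J.
    have : D * 2 ^ (- J) < D * 1.
      by apply: (lt_trans J1); apply: lt_le_trans rrn _; rewrite mulr1 ge_min lexx orbT.
    by rewrite ltr_pM2l// => h; apply: ltW; rewrite -(ltr_pow2 R) oppr0 expr0z.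
  set B := cell J (x n).
  have bB : cell j (x n) `<=` B by apply: cell_sub.
  have zx i : `|z 0 i - x n 0 i| <= c1 * nrm (z - x n).
    by have := Hc1 (z - x n) i; rewrite !mxE.
  have Bnear : B `<=` near_coord del z.
    move=> y By i; rewrite -(subrKA (x n 0 i)).
    apply: le_lt_trans (ler_normD _ _) _.
    have p1 : `|x n 0 i - y 0 i| < D^-1 * rr n.
      apply: (@lt_trans _ _ (2 ^ (- J))); first exact: (@cell_coord _ _ J (x n)).
      by rewrite -(@ltr_pM2l _ D)// mulrA divff ?gt_eqF// mul1r.
    have p2 : `|z 0 i - x n 0 i| <= c1 * rr n.
      by apply: (le_trans (zx i)); rewrite ler_pM2l// ltW.
    apply: (@le_lt_trans _ _ ((c1 + D^-1) * rr n)).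
      by rewrite mulrDl lerD// ltW.
    rewrite mulrC -ltr_pdivlMr//; apply: lt_le_trans rrn _.
    by rewrite ge_min lexx.
  have zdl : dl c B z.
    exists (x n) => // i; apply: (le_trans (zx i)).
    rewrite rdiam_cell// /c [2 * c1]mulrC -mulrA ler_pM2l//.
    exact: le_trans (ltW zn) J2.
  have BG : B `<=` G by move=> y /Bnear /Hdel [].
  have BK k : (k < K)%N -> ~ (B `&` mu k !=set0).
    by move=> kK [y [/Bnear/Hdel[_ h]]]; exact: h.
  have dB : dyadic B by exact: dyadic_cell.
  have db : dyadic (cell j (x n)) by exact: dyadic_cell.
  have hb : 0 <= phi (D * 2 ^ (- j)).
    by apply: (sf_ge0 hphi); rewrite ?mulr_ge0 ?ltW ?pow2_gt0// (lt_le_trans j1).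
  have lebB : (leb B <= (C * phi (D * 2 ^ (- j)))%:E)%E.
    rewrite leb_outer_cell// lee_fin /C mulrAC ler_pdivlMr ?exprn_gt0//.
    by rewrite -exprMn mulrC.
  have insideK k : inside mu B k -> (K <= k)%N.
    by move=> [[y ky] kB]; rewrite leqNgt; apply/negP => /BK; apply; exists y; split => //; exact: kB.
  have heavyB : heavy B -> (\bigcup_n T n) z.
    move=> hB; have [B' QB' BB'] := @max_cell_exists _ _ heavy 0 J (x n) J0 hB.
    have [m lamm] := Qlam _ QB'; exists m => //; right; rewrite lamm.
    by apply: le_dl BB' _ zdl => //; right => //; exact: Qd.
  (* If one [mu k] swallows the small cell, it either contains the large cell, or lies inside it and
     alone makes it heavy. Otherwise [mass] applied to the small cell makes the large one heavy. *)
  have [[k bk]|nobk] := pselect (exists k, cell j (x n) `<=` mu k).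
    have dk : dyadic (mu k).
      by case: (dmu k) => // mu0; have := bk _ (mem_cell j (x n)); rewrite mu0.
    have Kk : (K <= k)%N.
      rewrite leqNgt; apply/negP => /BK; apply; exists (x n); split => //; exact: bk.
    case: (@dyadic_nested _ _ B (mu k) (x n) dB dk) => //; first exact: bk.
      move=> Bk; exists k => //; left; rewrite Kk.
      by apply: le_dl Bk _ zdl => //; right.
    move=> kB; apply: heavyB; apply: (le_trans lebB).
    have ins : inside mu B k by split => //; exists (x n); exact: bk.
    apply: le_trans (nneseries_term k _); last first.
      by move=> i; case: ifP => // _; rewrite mule_ge0// lee_fin ltW.
    rewrite asboolT// /a Kk -EFinM lee_fin ler_pM2l// -(rdiam_cell d0 hnrm j (x n)).
    apply: (sf_mono hphi); [|apply: le_rdiam => //; by right|by case: (smu k)].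
    by apply: (rdiam_ge0 d0 hnrm); right.
  apply: heavyB; apply: (le_trans lebB).
  have lemass : ((phi (D * 2 ^ (- j)))%:E <= \sum_(i <oo)
      (if `[< inside mu (cell j (x n)) i >] then (wt (mu i))%:E else 0))%E.
    rewrite -(rdiam_cell d0 hnrm j (x n)).
    apply: (mass d0 hnrm hphi) => //.
    - by rewrite rdiam_cell// ltW// (lt_le_trans j1).
    - apply: null => //; exact: subset_trans bB BG.
    - by move=> k bk; apply: nobk; exists k.
  rewrite EFinM.
  apply: (@le_trans _ _ (C%:E * \sum_(i <oo)
      (if `[< inside mu (cell j (x n)) i >] then (wt (mu i))%:E else 0))%E).
    by rewrite lee_pmul2l ?lte_fin.
  rewrite -nneseriesZl; last by move=> i _; case: ifP => // _; rewrite lee_fin.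
  apply: lee_nneseries => [i _ _|i _].
    by rewrite mule_ge0 ?lee_fin ?(ltW C0)//; case: ifP => // _; rewrite lee_fin.
  case: asboolP => [[ni ib]|_]; last by rewrite mule0; case: ifP => // _; rewrite mule_ge0// lee_fin ltW.
  have iB : inside mu B i by split => //; exact: subset_trans bB.
  by rewrite asboolT// /a (insideK _ iB).
apply: le_trans (le_leb_outer cov) _.
apply: le_trans (leb_outerU d0 _ _) _; rewrite rr_full add0e.
apply: le_trans (leb_outerU d0 _ _) _; rewrite leb_outer_grid// add0e.
apply: le_trans (leb_outer_bigcup _) _.
have lebT n : (leb (T n) <= Kc%:E * (((D ^+ d)^-1)%:E * a n + leb (lam n)))%E.
  apply: le_trans (leb_outerU d0 _ _) _.
  rewrite ge0_muleDr ?leb_outer_ge0//; last by rewrite mule_ge0// lee_fin invr_ge0 exprn_ge0// ltW.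
  apply: leeD; last exact: leb_dl.
  rewrite /a; case: ifP => _; last by rewrite leb_outer_set0// !mule0.
  apply: le_trans (leb_dl d0 hnrm c0 (dmu n)) _.
  by rewrite lee_wpmul2l// ?lee_fin// -EFinM; exact: (leb_le_wt d0 hnrm hphi (smu n)).
apply: (@le_trans _ _ (\sum_(n <oo) (Kc%:E * (((D ^+ d)^-1)%:E * a n + leb (lam n))))%E).
  by apply: lee_nneseries => [n _ _|n _]; [exact: leb_outer_ge0|exact: lebT].
have Da n : (0 <= ((D ^+ d)^-1)%:E * a n)%E.
  by rewrite mule_ge0// lee_fin invr_ge0 exprn_ge0// ltW.
rewrite nneseriesZl; last by move=> n _; rewrite adde_ge0// leb_outer_ge0.
rewrite nneseriesD; [|by move=> n _ _; exact: Da|by move=> n _ _; exact: leb_outer_ge0].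
apply: (@le_trans _ _ (Kc%:E * (((D ^+ d)^-1)%:E * (e / (C' + 1))%:E + C%:E * (e / (C' + 1))%:E))%E).
  rewrite lee_wpmul2l ?lee_fin//; apply: leeD.
    by rewrite nneseriesZl// lee_wpmul2l ?lee_fin ?invr_ge0 ?exprn_ge0// ltW.
  apply: (le_trans lamsum); rewrite nneseriesZl//.
  by rewrite lee_wpmul2l ?lee_fin ?(ltW C0)// ltW.
rewrite -[(_ + _)%E]EFinD -EFinM lee_fin -mulrDl mulrA -/C'.
have C1 : 0 < C' + 1 by rewrite ltr_wpDl.
by rewrite mulrA ler_pdivrMr// mulrC ler_pM2l// lerDl.
Qed.

(** The sets [G' m] exhaust [G] and have closure in [G]. If each had null trace off [M], countable
    subadditivity would make [G] minus [M] null; this stands in for inner regularity. *)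
Lemma shrink (G M : set V) : open G -> leb (G `\` M) != 0%E ->
  exists G' : set V, [/\ open G', closure G' `<=` G & leb (G' `\` M) != 0%E].
Proof.
move=> oG; apply: contra_neqP => noG'.
pose e (m : nat) : R := m.+1%:R^-1 / 2.
have ee0 m : 0 < e m by rewrite divr_gt0.
pose E m : set V := [set z | near_coord (e m + e m) z `<=` G].
pose G' m : set V := \bigcup_(z in E m) near_coord (e m) z.
apply: (@leb_outerS_eq0 _ _ _ (\bigcup_m (G' m `\` M))).
  move=> z [Gz Mz]; have [del del0 Hdel] := (open_coordP G).1 oG z Gz.
  have [m mdel] : exists m : nat, m.+1%:R^-1 < del.
    exists (Num.bound del^-1); rewrite invf_plt ?posrE//.
    have del1 : 0 <= del^-1 by rewrite invr_ge0 ltW.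
    by apply: lt_trans (archi_boundP del1) _; rewrite ltr_nat.
  exists m => //; split => //; exists z; last by move=> i; rewrite subrr normr0.
  move=> y zy; apply: Hdel => i; apply: lt_trans (zy i) _.
  by rewrite /e -splitr.
apply: leb_outer_bigcup_eq0 => // m; apply/eqP/negPn/negP => Gm; apply: noG'.
exists (G' m); split => //.
  by apply: bigcup_open => z _; exact: near_coord_open.
move=> y cy; have [z' [[z Ez zz'] yz']] : (G' m `&` near_coord (e m) y) !=set0.
  apply: cy; apply/nbhs_coordP; by exists (e m).
by apply: Ez; apply: near_coord_trans zz' _; exact: near_coordC.
Qed.

(** Nested open sets, each with uncovered part of positive measure. Stage [k] leaves [mu k] and
    enters a ball of index at least [k]; a common point of the closures has all the required
    properties. *)
Lemma ubiquity_point (G0 : set V) (mu : nat -> set V) :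
  open G0 -> G0 `<=` U -> (forall n, small (mu n)) ->
  (\sum_(n <oo) (wt (mu n))%:E < +oo)%E ->
  leb (G0 `\` \bigcup_n mu n) != 0%E ->
  exists z, [/\ G0 z, io_ball nrm x r z & ~ (\bigcup_n mu n) z].
Proof.
move=> oG0 G0U smu muwt lG0.
set M := \bigcup_n mu n in lG0 *.
have dmu n : dyadic0 (mu n) by case: (smu n).
pose good (G : set V) := [/\ open G, G `<=` U & leb (G `\` M) != 0%E].
pose S (k : nat) (G : set V) : set V := [set z | [/\ G z, ~ mu k z &
  exists n, (k <= n)%N /\ nrm (z - x n) < r n]].
(* The choice is made for every set, with a dummy value on sets that are not [good], so that a plain
   recursion can iterate it. *)
have step (kG : nat * set V) : exists G', good kG.2 ->
    [/\ good G', closure G' `<=` S kG.1 kG.2 & exists j n, G' `<=` cell j (x n)].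
  case: kG => k G /=; have [[oG GU lG]|nG] := pselect (good G); last by exists set0.
  have [n [j [kn jr jG lj]]] := @uncovered_cell G mu (maxn k N0) oG GU smu muwt lG.
  move: kn; rewrite geq_max => /andP[kn N0n].
  (* Taking interiors discards only grid points from the uncovered part of the cell, so its positive
     measure survives. *)
  pose G1 := (cell j (x n))° `&` (~` mu k)°.
  have oG1 : open G1 by apply: openI; exact: open_interior.
  have lG1 : leb (G1 `\` M) != 0%E.
    apply: contra_neq lj => G10.
    apply: (@leb_outerS_eq0 _ _ _ ((G1 `\` M) `|` @grid R d)); last first.
      by apply: leb_outerU_eq0 => //; exact: leb_outer_grid.
    move=> z [zj zM]; have [gz|gz] := pselect (grid z); [by right|left].
    split => //; split.
      by apply/nbhs_coordP; rewrite -(cell_eq zj); exact: cell_nbhs.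
    case: (dmu k) => [->|/dyadicE [i [y muE]]]; first by rewrite setC0 interiorT.
    apply/nbhs_coordP; rewrite muE; apply: cell_compl_nbhs => // ziy.
    by apply: zM; exists k => //; rewrite muE.
  have [G' [oG' G'G1 lG']] := shrink oG1 lG1.
  have G'j : closure G' `<=` cell j (x n).
    by move=> z /G'G1 [/interior_subset].
  exists G' => _; split.
  - split => // z zG'; apply: GU; apply: jG; apply: G'j; exact: subset_closure.
  - move=> z zG'; have zj := G'j z zG'; split; first exact: jG.
      by have [_ /interior_subset] := G'G1 z zG'.
    exists n; split => //; apply: le_lt_trans jr.
    rewrite -lee_fin -(diam_cell d0 hnrm j (x n)); exact: diam_ge.
  - exists j, n; apply: subset_trans G'j; exact: subset_closure.
have [f fP] := choice step.
pose Gs := fix g n := if n is m.+1 then f (m, g m) else G0.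
have goodG n : good (Gs n).
  by elim: n => [|n IH]; [split|case: (fP (n, Gs n) IH)].
have SG n : closure (Gs n.+1) `<=` S n (Gs n) by case: (fP (n, Gs n) (goodG n)).
have Gdec n m : (n <= m)%N -> Gs m `<=` Gs n.
  elim: m => [|m IH]; first by rewrite leqn0 => /eqP ->.
  rewrite leq_eqVlt => /orP[/eqP ->//|/IH h]; apply: subset_trans h.
  by move=> z zG; have [] := SG m z (subset_closure zG).
have /choice [y yG] n : exists y, Gs n y.
  have [[z [Gz _]]|h] := pselect ((Gs n `\` M) !=set0); first by exists z.
  have [_ _] := goodG n; rewrite (_ : Gs n `\` M = set0) ?leb_outer_set0 ?eqxx//.
  by apply/seteqP; split => // z zG; apply: h; exists z.
have [j [n0 G1j]] : exists j n, Gs 1%N `<=` cell j (x n).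
  by case: (fP (0%N, Gs 0%N) (goodG 0%N)).
(* From stage 1 on, all sets lie in one cell, hence in this compact box, which provides a cluster
   point of the chosen sequence. *)
pose A i : set R := `[x n0 0 i - 2 ^ (- j), x n0 0 i + 2 ^ (- j)]%classic.
pose K : set V := [set v | forall i, A i (v ord0 i)].
have cK : compact K by apply: rV_compact => i; exact: segment_compact.
have yK : (y n @[n --> \oo]) K.
  exists 1%N => // n n1 i; rewrite /A/= in_itv/= -ler_distl.
  by apply/ltW/(@cell_coord _ _ j (x n0)) => //; apply: G1j; exact: Gdec (yG n).
have [z [_ zc]] := cK _ _ yK.
have zG n : closure (Gs n) z.
  move=> B nB; have : Gs n `&` B !=set0; last by [].
  by apply: zc => //; exists n => // m nm; exact: Gdec (yG m).
exists z; split.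
- by have [] := SG 0%N z (zG 1%N).
- by move=> N; have [_ _ [n [Nn zn]]] := SG N z (zG N.+1); exists n.
- by move=> [n _]; have [_ + _] := SG n z (zG n.+1); exact.
Qed.

(** If the cubes inside [L] leave a null part of [L], [mass] applies. Otherwise [ubiquity_point]
    yields a point of the limsup set in [L] missed by them; the cube of [mu] covering it must lie
    inside [L] by nesting, a contradiction. *)
Lemma full_content (mu : nat -> set V) (L : set V) :
  (forall n, dyadic0 (mu n)) -> dyadic L -> L `<=` U -> rdiam L <= e0 ->
  io_ball nrm x r `&` L `<=` \bigcup_n mu n -> (forall n, ~ L `<=` mu n) ->
  ((wt L)%:E <= \sum_(n <oo) (if `[< inside mu L n >] then (wt (mu n))%:E else 0))%E.
Proof.
move=> dmu dL LU Le cov nomu.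
pose nu n := if `[< inside mu L n >] then mu n else set0.
have smnu n : small (nu n).
  rewrite /nu; case: asboolP => [[_ nL]|_]; last first.
    by split; [left|rewrite rdiam_set0// ltW// (sf_e0 hphi)].
  by split => //; apply: le_trans Le; apply: le_rdiam => //; right.
have nuE n : (if `[< inside mu L n >] then (wt (mu n))%:E else 0%E) = (wt (nu n))%:E.
  by rewrite /nu; case: ifP => // _; rewrite (wt_set0 _ hphi).
have [sumoo|sumfin] := eqVneq (\sum_(n <oo) (wt (nu n))%:E)%E +oo%E.
  by under eq_eseriesr do rewrite nuE; rewrite sumoo leey.
have insE n : inside nu L n = inside mu L n.
  apply/propext; split; rewrite /inside /nu; case: asboolP => //.
  by move=> _ [[]].
have [L0|L0] := eqVneq (leb (L `\` \bigcup_n nu n)) 0%E.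
  apply: le_trans (@mass _ _ d0 nrm hnrm phi e0 hphi nu L _ dL Le L0 _) _.
  - by move=> n; case: (smnu n).
  - move=> n; rewrite /nu; case: ifP => _; first exact: nomu.
    by have [y Ly] := dyadic_neq0 dL; move=> /(_ y Ly).
  rewrite le_eqVlt; apply/orP; left; apply/eqP; apply: eq_eseriesr => n _.
  by rewrite insE nuE /nu; case: asboolP => // _; rewrite (wt_set0 _ hphi).
have lint : leb (L° `\` \bigcup_n nu n) != 0%E.
  apply: contra_neq L0 => h.
  apply: (@leb_outerS_eq0 _ _ _ ((L° `\` \bigcup_n nu n) `|` @grid R d)); last first.
    by apply: leb_outerU_eq0 => //; exact: leb_outer_grid.
  move=> z [zL zM]; have [gz|gz] := pselect (grid z); [by right|left; split => //].
  have [j LE] := dyadicP dL zL; apply/nbhs_coordP; rewrite LE; exact: cell_nbhs.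
have LU' : L° `<=` U := subset_trans (@interior_subset _ _) LU.
have sumlt : (\sum_(n <oo) (wt (nu n))%:E < +oo)%E by rewrite ltey.
have [z [/interior_subset Lz zF znu]] := ubiquity_point (@open_interior _ L) LU' smnu sumlt lint.
have [n _ nz] := cov z (conj zF Lz).
have dn : dyadic (mu n) by case: (dmu n) => // mu0; rewrite mu0 in nz.
case: (dyadic_nested dL dn Lz nz) => [/nomu//|nL].
case: znu; exists n => //; rewrite /nu asboolT//; split => //; by exists z.
Qed.

End ubiquity.

(** * Gauges *)

Section gauges.
Variables (R : realType) (d : nat).
Hypothesis d0 : (0 < d)%N.
Implicit Types (g h : \bar R -> \bar R) (r s : R).
Local Notation dnorm := (@dnorm R d).

Definition ratio_inf g r : \bar R :=
  ereal_inf [set (g rho%:E * ((rho ^+ d)^-1)%:E)%E | rho in `]0%R, r] ].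

Lemma powd_gt0 r : 0 < r -> 0 < r ^+ d. Proof. exact: exprn_gt0. Qed.

Lemma dnormE g r : 0 < r -> dnorm g r%:E = ((r ^+ d)%:E * ratio_inf g r)%E.
Proof. by move=> r0; rewrite /= leNgt r0. Qed.

Lemma dnorm0 g : dnorm g 0%E = 0%E.
Proof. by rewrite /= lexx. Qed.

Lemma ratio_inf_anti g r s : r <= s -> (ratio_inf g s <= ratio_inf g r)%E.
Proof.
move=> rs; apply: ereal_inf_le_tmp => _ [rho /= + <-]; rewrite in_itv/= => /andP[rho0 rhor].
by exists rho => //=; rewrite in_itv/= rho0 (le_trans rhor).
Qed.

Lemma ratio_inf_le g r s : 0 < s -> s <= r -> (ratio_inf g r <= g s%:E * ((s ^+ d)^-1)%:E)%E.
Proof.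
by move=> s0 sr; apply: ereal_inf_lbound; exists s => //=; rewrite in_itv/= s0.
Qed.

Lemma ratio_inf_ge g r (M : \bar R) :
  (forall s, 0 < s -> s <= r -> (M <= g s%:E * ((s ^+ d)^-1)%:E)%E) -> (M <= ratio_inf g r)%E.
Proof.
move=> HM; apply: le_ereal_inf_tmp => _ [rho /= + <-].
by rewrite in_itv/= => /andP[rho0 rhor]; exact: HM.
Qed.

Lemma mule_powVK (a : \bar R) r : 0 < r -> ((r ^+ d)%:E * (a * ((r ^+ d)^-1)%:E) = a)%E.
Proof. by move=> r0; rewrite muleCA -EFinM divff ?mule1// gt_eqF// powd_gt0. Qed.

Lemma mule_powK (a : \bar R) r : 0 < r -> ((r ^+ d)%:E * a * ((r ^+ d)^-1)%:E = a)%E.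
Proof. by move=> r0; rewrite -muleA mule_powVK. Qed.

Section gauge.
Variable g : \bar R -> \bar R.
Hypothesis gg : gauge g.

Lemma gauge_ge0 r : 0 <= r -> (0 <= g r%:E)%E.
Proof. by move=> r0; case: gg => + _ _ _ _; apply; rewrite lee_fin. Qed.

Lemma ratio_inf_ge0 r : (0 <= ratio_inf g r)%E.
Proof.
apply: ratio_inf_ge => s s0 _.
by rewrite mule_ge0 ?gauge_ge0 ?lee_fin ?invr_ge0 ?exprn_ge0 ?(ltW s0).
Qed.

Lemma dnorm_ge0 (u : \bar R) : (0 <= dnorm g u)%E.
Proof.
case: u => [r| |]; [|by rewrite /= leey|by rewrite /=].
have [r0|r0] := leP r 0; first by rewrite /= r0.
by rewrite dnormE// mule_ge0 ?ratio_inf_ge0// lee_fin ltW// powd_gt0.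
Qed.

Lemma dnorm_le r : 0 <= r -> (dnorm g r%:E <= g r%:E)%E.
Proof.
rewrite le_eqVlt => /predU1P[<-|r0]; first by rewrite dnorm0 gauge_ge0.
rewrite dnormE// -[leRHS](mule_powVK _ r0) lee_pmul2l// ?lte_fin ?powd_gt0//.
exact: ratio_inf_le.
Qed.

(** A gauge may be infinite away from [0], but the infimum also runs over arguments so small that
    the gauge is below 1. *)
Lemma dnorm_fin r : dnorm g r%:E \is a fin_num.
Proof.
have [r0|r0] := leP r 0; first by rewrite /= r0.
rewrite ge0_fin_numE ?dnorm_ge0// dnormE//.
case: gg => _ _ /(_ 1 ltr01) [del del0 Hdel] _ _.
pose s := Num.min r (del / 2).
have s0 : 0 < s by rewrite lt_min r0 divr_gt0.
have sdel : s < del by rewrite gt_min orbC ltr_pdivrMr// ltr_pMr// ltr1n.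
apply: (@le_lt_trans _ _ ((r ^+ d)%:E * (1 * ((s ^+ d)^-1)%:E))%E).
  rewrite lee_pmul2l// ?lte_fin ?powd_gt0//.
  apply: le_trans (ratio_inf_le g s0 _) _; first by rewrite ge_min lexx.
  by rewrite lee_wpmul2r ?lee_fin ?invr_ge0 ?exprn_ge0 ?(ltW s0)// ltW// Hdel.
by rewrite mul1e -EFinM ltry.
Qed.

Lemma dnorm_mono : exists2 e, 0 < e & forall r s, 0 <= r -> r <= s -> s <= e ->
  (dnorm g r%:E <= dnorm g s%:E)%E.
Proof.
case: gg => _ [e e0 gmono] _ _ _; exists e => // r s.
rewrite le_eqVlt => /predU1P[<- _ _|r0 rs se]; first by rewrite dnorm0 dnorm_ge0.
have s0 := lt_le_trans r0 rs.
rewrite [X in (_ <= X)%E]dnormE// -lee_pdivrMl ?powd_gt0//; apply: ratio_inf_ge => t t0 ts.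
rewrite lee_pdivrMl ?powd_gt0//.
have gt0 : (0 <= g t%:E * ((t ^+ d)^-1)%:E)%E.
  by rewrite mule_ge0 ?gauge_ge0 ?lee_fin ?invr_ge0 ?exprn_ge0 ?(ltW t0).
(* For [t <= r] the argument [t] already competes in the infimum at [r]; for [r < t] the
   monotonicity of [g] is used instead. *)
have [tr|rt] := leP t r.
  apply: (@le_trans _ _ ((r ^+ d)%:E * (g t%:E * ((t ^+ d)^-1)%:E))%E).
    by rewrite dnormE// lee_pmul2l ?lte_fin ?powd_gt0//; exact: ratio_inf_le.
  by rewrite lee_wpmul2r// lee_fin lerXn2r ?nnegrE// ltW.
apply: le_trans (dnorm_le (ltW r0)) _.
apply: le_trans (gmono r t (ltW r0) (ltW rt) (le_trans ts se)) _.
rewrite -[leLHS](mule_powVK _ t0) lee_wpmul2r// lee_fin lerXn2r ?nnegrE// ltW//.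
Qed.

Lemma gauge_dnorm : gauge (dnorm g).
Proof.
split => //.
- by move=> u _; exact: dnorm_ge0.
- by have [e e0 h] := dnorm_mono; exists e.
- case: gg => _ _ g0 _ _ e /g0 [del del0 Hdel]; exists del => // r r0 rdel.
  by apply: le_lt_trans (dnorm_le (ltW r0)) _; exact: Hdel.
- exact: dnorm0.
Qed.

Lemma dnormalized_dnorm : dnormalized d (dnorm g).
Proof.
exists 1 => // r; rewrite le_eqVlt => /predU1P[<- _|r0 _]; first by rewrite !dnorm0.
rewrite !dnormE//; congr (_ * _)%E; apply/eqP; rewrite eq_le; apply/andP; split.
  apply: ratio_inf_ge => s s0 sr; rewrite dnormE// mule_powK//.
  exact: ratio_inf_anti.
apply: ratio_inf_ge => s s0 sr; apply: le_trans (ratio_inf_le (dnorm g) s0 sr) _.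
by rewrite dnormE// mule_powK//; exact: ratio_inf_le.
Qed.

End gauge.

(** A lower bound [M] for [g s / s ^+ d] on an interval at [0] is also one for its infimum there, so
    normalization keeps it. *)
Lemma Ginf_dnorm g : Ginf d g -> forall M, exists2 del, 0 < del &
  forall r, 0 < r -> r < del -> ((M * r ^+ d)%:E <= dnorm g r%:E)%E.
Proof.
move=> [gg ellg] M.
have : (M%:E < ell d g)%E by rewrite ellg ltry.
rewrite /ell => /ereal_sup_gt [_ [del del_pos <-] Mdel].
have del0 : 0 < del by move: del_pos; rewrite /= in_itv/= andbT.
exists del => // r r0 rdel.
rewrite dnormE// mulrC EFinM lee_pmul2l ?lte_fin ?powd_gt0//.
apply: ratio_inf_ge => s s0 sr; apply: le_trans (ltW Mdel) _.
by apply: ereal_inf_lbound; exists s => //=; rewrite in_itv/= s0 (le_lt_trans sr).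
Qed.

Definition rgauge h r : R := fine (h r%:E).

Lemma gauge_scale h (e1 : R) : gauge h -> dnormalized d h -> 0 < e1 ->
  (exists2 e, 0 < e & forall r, 0 < r -> r < e -> ((r ^+ d)%:E <= h r%:E)%E) ->
  exists e0, [/\ e0 <= e1, scale_fun d (rgauge h) e0,
    forall r, 0 <= r -> r <= e0 -> h r%:E = (rgauge h r)%:E & (e0%:E < eps_h d h)%E].
Proof.
move=> gh [en en0 hn] e10 [er er0 hr].
case: (gh) => _ [em em0 hm] /(_ 1 ltr01) [ef ef0 hf] h0 _.
(* The thresholds are: the prescribed bound, normalization, domination of [r ^+ d], monotonicity,
   and values below 1. Then [e <= eps_h], and halving [e] makes the inequality strict. *)
pose e := Num.min (Num.min e1 en) (Num.min er (Num.min em ef)).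
have e_gt0 : 0 < e by rewrite !lt_min e10 en0 er0 em0 ef0.
have [ee1 een] : e <= e1 /\ e <= en by rewrite !ge_min !lexx !orbT.
have [eer [eem eef]] : e <= er /\ e <= em /\ e <= ef by rewrite !ge_min !lexx !orbT.
have e2 : e / 2 < e by rewrite ltr_pdivrMr// ltr_pMr// ltr1n.
have fin r : 0 <= r -> r <= e / 2 -> h r%:E = (rgauge h r)%:E.
  rewrite le_eqVlt => /predU1P[<- _|rp re]; first by rewrite /rgauge h0.
  rewrite /rgauge fineK// ge0_fin_numE ?gauge_ge0// ?ltW//.
  apply: (@lt_le_trans _ _ 1%E); last by rewrite leey.
  by apply: hf => //; apply: lt_le_trans (le_lt_trans re e2) eef.
have mono r s : 0 <= r -> r <= s -> s <= e -> (h r%:E <= h s%:E)%E.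
  by move=> ? ? se; apply: hm => //; exact: le_trans eem.
have rat r s : 0 < r -> r <= s -> s <= e ->
    (h s%:E * ((s ^+ d)^-1)%:E <= h r%:E * ((r ^+ d)^-1)%:E)%E.
  move=> rp rs se; have sp := lt_le_trans rp rs.
  rewrite (hn s (ltW sp) (le_trans se een)) (hn r (ltW rp) (le_trans rs (le_trans se een))).
  by rewrite !dnormE// !mule_powK//; exact: ratio_inf_anti.
exists (e / 2); split => //.
- by apply: le_trans ee1; exact: ltW.
- split => //.
  + by rewrite divr_gt0.
  + by rewrite /rgauge h0.
  + move=> r s r0 rs se; rewrite -lee_fin -!fin ?(le_trans rs)// ?(le_trans r0)//.
    by apply: mono => //; rewrite (le_trans se)// ltW.
  + move=> r s r0 rs se; have s0 := lt_le_trans r0 rs.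
    have := rat r s r0 rs (le_trans se (ltW e2)).
    rewrite !fin ?(ltW r0) ?(ltW s0)// ?(le_trans rs)// -!EFinM lee_fin.
    by rewrite ler_pdivrMr ?powd_gt0// mulrAC ler_pdivlMr ?powd_gt0.
  + move=> r; rewrite le_eqVlt => /predU1P[<- _|rp re].
      by rewrite /rgauge h0 expr0n eqn0Ngt d0.
    rewrite -lee_fin -fin ?(ltW rp)//; apply: hr => //.
    by apply: le_lt_trans re _; apply: lt_le_trans e2 _.
- apply: (@lt_le_trans _ _ e%:E); first by rewrite lte_fin.
  by apply: ereal_sup_ubound; exists e.
Qed.

End gauges.

(** * Coverings of balls *)

Section coverings.
Variables (R : realType) (d : nat).
Hypothesis d0 : (0 < d)%N.
Local Notation V := 'rV[R]_d.
Variable nrm : V -> R.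
Hypothesis hnrm : is_norm nrm.
Local Notation D := (@cube_diam R d nrm).
Local Notation rdiam := (@rdiam R d nrm).

(** A block of [m0] cubes along each axis suffices, with [m0 <= 2 * c1 * s * 2 ^ j + 2]. Since
    [2 ^ j <= 2 * D / rho] and [rho <= s], this is at most [(4 * c1 * D + 2) * (s / rho)]. *)
Lemma ball_cover : exists2 C : R, 0 < C & forall (c : V) (s rho : R), 0 < rho -> rho <= s ->
  exists (m : nat) (L : nat -> set V), [/\ m%:R <= C * (s / rho) ^+ d,
    forall i, dyadic (L i) /\ rdiam (L i) < rho &
    [set y | nrm (y - c) < s] `<=` \bigcup_(i in `I_m) L i].
Proof.
have D0 := cube_diam_gt0 d0 hnrm.
have [c1 c10 Hc1] := nrm_ge_coord d0 hnrm.
exists ((4 * c1 * D + 2) ^+ d); first by rewrite exprn_gt0// addr_gt0// !mulr_gt0.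
move=> c s rho rho0 rhos; have s0 := lt_le_trans rho0 rhos.
have [j /andP[j1 j2]] := dyadic_scale d0 hnrm rho0.
pose z := 2 * c1 * s * 2 ^ j + 1.
have z0 : 0 <= z by rewrite addr_ge0// !mulr_ge0 ?(ltW c10) ?(ltW s0) ?(ltW (pow2_gt0 _ _)).
pose m0 := `|Num.floor z|.+1.
have m0E : m0%:R = (Num.floor z + 1)%:~R :> R.
  rewrite /m0 -natr1 rmorphD/=; congr (_ + _).
  by rewrite natr_absz ger0_norm// floor_ge0.
have zm0 : z < m0%:R by rewrite m0E; have /andP[] := floor_itv z.
have m0z : m0%:R <= z + 1 by rewrite m0E rmorphD/= lerD2r floor_le.
pose k i := Num.floor (2 ^ j * (c 0 i - c1 * s)).
pose pt (t : {ffun 'I_d -> 'I_m0}) : V := \row_i ((k i + (t i)%:Z)%:~R / 2 ^ j).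
exists #|{: {ffun 'I_d -> 'I_m0}}|.
exists (fun i => if insub i is Some o then cell j (pt (enum_val (o : 'I_#|{: {ffun 'I_d -> 'I_m0}}|)))
                 else cell j 0).
split.
- rewrite card_ffun !card_ord natrX -exprMn lerXn2r ?nnegrE//.
    by rewrite mulr_ge0 ?divr_ge0 ?(ltW s0) ?(ltW rho0)// addr_ge0// !mulr_ge0 ?(ltW c10) ?(ltW D0).
  apply: (le_trans m0z); rewrite /z -addrA (_ : 1 + 1 = 2 :> R)// [leRHS]mulrDl; apply: lerD; last first.
    by rewrite ler_pMr// ler_pdivlMr// mul1r.
  rewrite [leRHS](_ : _ = 2 * c1 * s * (2 * D / rho)); last by field; rewrite gt_eqF.
  apply: ler_wpM2l; first by rewrite !mulr_ge0 ?(ltW c10) ?(ltW s0).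
  rewrite ler_pdivlMr//; move: j2; rewrite -invr_expz mulrA ler_pdivlMr ?pow2_gt0// mulrC.
  by rewrite mulrC.
- by move=> i; case: insub => [q|]; split; rewrite ?rdiam_cell//; exact: dyadic_cell.
- move=> y /= ys.
  have yc i : `|y 0 i - c 0 i| <= c1 * s.
    have := Hc1 (y - c) i; rewrite !mxE => /le_trans; apply.
    by rewrite ler_pM2l// ltW.
  have lo i : k i <= Num.floor (2 ^ j * y 0 i).
    rewrite /k; apply: le_floor.
    by rewrite ler_pM2l ?pow2_gt0//; have := yc i; rewrite ler_norml; lra.
  have hi (i : 'I_d) : (absz (Num.floor (2 ^ j * y 0 i) - k i)%R < m0)%N.
    rewrite -ltz_nat gez0_abs ?subr_ge0// -(ltr_int R) rmorphB/=; apply: le_lt_trans zm0.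
    have h1 := floor_le (2 ^ j * y 0 i).
    have /andP[_ h2] := floor_itv (2 ^ j * (c 0 i - c1 * s)).
    rewrite rmorphD/= in h2.
    have h3 : 2 ^ j * y 0 i <= 2 ^ j * (c 0 i + c1 * s).
      by rewrite ler_pM2l ?pow2_gt0//; have := yc i; rewrite ler_norml; lra.
    rewrite /z /k; move: h1 h2 h3; rewrite !mulrDr mulrN.
    have -> : 2 * c1 * s * 2 ^ j = 2 * (2 ^ j * (c1 * s)) by ring.
    lra.
  pose t : {ffun 'I_d -> 'I_m0} := [ffun i => Ordinal (hi i)].
  exists (enum_rank t); first exact: ltn_ord.
  rewrite valK enum_rankK => i; rewrite mxE ffunE/=.
  rewrite [2 ^ j * (_ / _)]mulrC divfK ?pow2_neq0// gez0_abs ?subr_ge0// subrKC.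
  by apply/esym/floor_def; rewrite lexx ltr_int ltrDl.
Qed.

(** The cube size [rho n] is left free below the radius [s n]: equal to it for contents, half of it
    when arbitrary covers are made dyadic, and tuned to the infimum defining [dnorm] when the gauge
    is not normalized. *)
Lemma cover_sum : exists2 C : R, 0 < C & forall (h : \bar R -> \bar R) (e : R)
    (c : nat -> V) (s rho : nat -> R), gauge h ->
  (forall a b : R, 0 <= a -> a <= b -> b <= e -> (h a%:E <= h b%:E)%E) ->
  (forall n, [/\ 0 < rho n, rho n <= s n & rho n <= e]) ->
  exists E : nat -> set V, [/\
    forall k, E k = set0 \/ dyadic (E k) /\ (exists n, rdiam (E k) < rho n),
    \bigcup_n [set y | nrm (y - c n) < s n] `<=` \bigcup_n E n &
    (\sum_(k <oo) h (diam nrm (E k)) <=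
     \sum_(n <oo) (C * (s n / rho n) ^+ d)%:E * h (rho n)%:E)%E].
Proof.
have [C C0 HC] := ball_cover; exists C => // h e c s rho gh hmono hrho.
have h0 : h 0%E = 0%E by case: gh.
have hge u : (0 <= h (diam nrm u))%E by case: gh => + _ _ _ _; apply; exact: diam_ge0.
have /choice [mL mLP] n : exists mL : nat * (nat -> set V), [/\ mL.1%:R <= C * (s n / rho n) ^+ d,
    forall i, dyadic (mL.2 i) /\ rdiam (mL.2 i) < rho n &
    [set y | nrm (y - c n) < s n] `<=` \bigcup_(i in `I_mL.1) mL.2 i].
  have [rn0 rs _] := hrho n; have [m [L HL]] := HC (c n) _ _ rn0 rs.
  by exists (m, L).
pose f n i := if (i < (mL n).1)%N then (mL n).2 i else set0.
have [p bp] := nat_pair_bij.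
exists (fun k => f (p k).1 (p k).2); split.
- move=> k; rewrite /f; case: ifP => _; [right|by left].
  by have [_ /(_ (p k).2) [? ?] _] := mLP (p k).1; split => //; exists (p k).1.
- move=> y [n _ yn]; have [_ _ /(_ y yn) [i /= im yi]] := mLP n.
  have [_ _ /(_ (n, i) I) [k _ pk]] := bp.
  by exists k => //; rewrite pk /f im.
- rewrite (nneseries_pair (f := fun n i => h (diam nrm (f n i))) bp)//.
  apply: lee_nneseries => [n _ _|n _]; first exact: nneseries_ge0.
  have [rn0 rs re] := hrho n; have [m_le mLd _] := mLP n.
  rewrite (@nneseries_finite _ _ (mL n).1)//; last first.
    by move=> i im; rewrite /f ltnNge im diam_set0// h0.
  apply: (@le_trans _ _ (\sum_(i < (mL n).1) h (rho n)%:E)%E).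
    apply: lee_sum => i _; rewrite /f ltn_ord.
    have [dL rL] := mLd i.
    rewrite diam_rdiam//; last by right.
    by apply: hmono => //; [apply: rdiam_ge0 => //; right|exact: ltW].
  have -> : (\sum_(i < (mL n).1) h (rho n)%:E = ((mL n).1%:R)%:E * h (rho n)%:E)%E.
    by rewrite mule_natl sumr_const card_ord.
  apply: lee_wpmul2r; last by rewrite lee_fin.
  by apply: (gauge_ge0 gh); exact: ltW.
Qed.

End coverings.

Section more_series.
Variable R : realType.
Implicit Types (u v : nat -> \bar R).
Local Open Scope ereal_scope.

(** Finite terms put the divergence of [u] entirely in its tail, where the comparison holds. *)
Lemma nneseries_shift_oo u v N : (forall n, 0 <= u n) -> (forall n, 0 <= v n) ->
  (forall n, u n \is a fin_num) -> (forall n, (N <= n)%N -> u n <= v n) ->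
  \sum_(n <oo) u n = +oo -> \sum_(n <oo) v n = +oo.
Proof.
move=> u0 v0 fu uv; rewrite (nneseries_split 0 N)// add0n => H.
have f : (\sum_(0 <= k < N) u k)%R \is a fin_num.
  by rewrite sum_fin_num; apply/allP => a /mapP [i _ ->]; exact: fu.
have tail : \sum_(N <= n <oo) u n = +oo.
  by move: H; rewrite -(fineK f); case: (\sum_(N <= n <oo) u n).
rewrite (nneseries_split 0 N)// add0n.
suff -> : \sum_(N <= n <oo) v n = +oo.
  by rewrite addey// gt_eqF// (lt_le_trans ltNy0)// sume_ge0.
apply/eqP; rewrite -leye_eq -tail !ereal_series.
apply: lee_nneseries => [n _ _|n Nn]; [exact: u0|exact: uv].
Qed.

Lemma nneseries_lt_cvg0 (a : nat -> R) : (forall n, 0 <= a n)%R ->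
  \sum_(n <oo) (a n)%:E < +oo ->
  forall e : R, (0 < e)%R -> exists N, forall n, (N <= n)%N -> (a n < e)%R.
Proof.
move=> a0 afin e e0.
have ae n : 0 <= (a n)%:E by rewrite lee_fin.
have [N HN] := nneseries_tail_lt ae afin e0; exists N => n Nn.
rewrite -lte_fin; apply: le_lt_trans HN; rewrite -(subnK Nn).
rewrite -(nneseries_addn N ae).
exact: (nneseries_term (u := fun i => (a (i + N)%N)%:E)).
Qed.

End more_series.

(** * Limsup sets of balls: topology and measure *)

Section borel.
Variables (R : realType) (d : nat).
Hypothesis d0 : (0 < d)%N.
Local Notation V := 'rV[R]_d.
Variable nrm : V -> R.
Hypothesis hnrm : is_norm nrm.

Lemma io_ball_bigcap (x : nat -> V) r :
  io_ball nrm x r = \bigcap_N \bigcup_(n in [set n | (N <= n)%N]) [set y | nrm (y - x n) < r n].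
Proof.
apply/seteqP; split => y h N; first by have [n Nn yn] := h N; exists n.
by have [n Nn yn] := h N I; exists n.
Qed.

Lemma Gdelta_io_ball (x : nat -> V) r : Gdelta (io_ball nrm x r).
Proof.
exists (fun N => \bigcup_(n in [set n | (N <= n)%N]) [set y | nrm (y - x n) < r n]).
split; last exact: io_ball_bigcap.
by move=> N; apply: bigcup_open => n _; exact: nrm_ball_open.
Qed.

Lemma borel_Gdelta (F : set V) : Gdelta F -> borel F.
Proof.
move=> [A [oA ->]]; rewrite -[X in borel X]setCK setC_bigcap -setTD.
apply: sigma_algebraCD; apply: sigma_algebra_bigcup => n; rewrite -setTD.
by apply: sigma_algebraCD; apply: sub_sigma_algebra; exact: oA.
Qed.

(** Borel-Cantelli: a tail of the balls covers, and each ball lies in a box of side [3 * C * s]. *)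
Lemma leb_outer_io_ball (x : nat -> V) r : (forall n, 0 <= r n) ->
  (\sum_(n <oo) ((r n) ^+ d)%:E < +oo)%E -> leb_outer (io_ball nrm x r) = 0%E.
Proof.
move=> r0 rfin; have [C C0 HC] := nrm_ge_coord d0 hnrm.
apply/eqP; rewrite eq_le leb_outer_ge0 andbT; apply/lee_addgt0Pr => e e0; rewrite add0e.
have C3 : 0 < (3 * C) ^+ d by rewrite exprn_gt0// mulr_gt0.
have rd n : (0 <= ((r n) ^+ d)%:E)%E by rewrite lee_fin exprn_ge0.
have [N HN] := nneseries_tail_lt rd rfin (divr_gt0 e0 C3).
pose B n : set V := [set y | nrm (y - x (n + N)%N) < r (n + N)%N].
apply: (@le_trans _ _ (leb_outer (\bigcup_n B n))).
  apply: le_leb_outer => y /(_ N) [n Nn yn]; exists (n - N)%N => //.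
  by rewrite /B/= subnK.
apply: le_trans (leb_outer_bigcup _) _.
apply: (@le_trans _ _ (\sum_(n <oo) (((3 * C) ^+ d)%:E * ((r (n + N)%N) ^+ d)%:E))%E).
  apply: lee_nneseries => [n _ _|n _]; first exact: leb_outer_ge0.
  set s := r (n + N)%N; set c := x (n + N)%N.
  have s0 : 0 <= s by exact: r0.
  pose a : V := \row_i (c 0 i - C * s); pose b : V := \row_i (c 0 i + 2 * (C * s)).
  apply: (@le_trans _ _ (leb_outer (box a b))).
    apply: le_leb_outer => y /= ys i; rewrite !mxE.
    have := HC (y - c) i; rewrite !mxE => h.
    have Cs : C * nrm (y - c) < C * s by rewrite ltr_pM2l.
    have := le_lt_trans h Cs; rewrite ltr_norml => /andP[h1 h2].
    by apply/andP; split; lra.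
  apply: le_trans (leb_outer_box d0 _ _) _; rewrite -EFinM lee_fin -exprMn /box_vol.
  rewrite (eq_bigr (fun=> 3 * C * s)); first by rewrite prodr_const card_ord.
  by move=> i _; rewrite !mxE max_l; [ring|have := mulr_ge0 (ltW C0) s0; lra].
rewrite nneseriesZl// (nneseries_addn (f := fun n => ((r n) ^+ d)%:E))//.
apply: (@le_trans _ _ (((3 * C) ^+ d)%:E * (e / (3 * C) ^+ d)%:E)%E).
  by rewrite lee_pmul2l// ?lte_fin// ltW.
by rewrite -EFinM lee_fin mulrC divfK// gt_eqF.
Qed.

End borel.

(** * Enlarged radii to which eutaxy applies *)

Section radii.
Variables (R : realType) (d : nat).
Hypothesis d0 : (0 < d)%N.

Lemma pow_root (a : R) : 0 <= a -> (a `^ d%:R^-1) ^+ d = a.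
Proof.
move=> a0; rewrite -powR_mulrn ?powR_ge0// -powRrM mulVf ?powRr1//.
by rewrite pnatr_eq0 -lt0n.
Qed.

Variables (phi : R -> R) (e0 : R).
Hypothesis hphi : scale_fun d phi e0.
Hypothesis phi_cvg : forall e, 0 < e -> exists2 del, 0 < del & forall s, 0 < s -> s < del -> phi s < e.
Variable r : nat -> R.
Hypothesis r_pos : forall n, 0 < r n.
Hypothesis r_dec : forall n, r n.+1 <= r n.
Hypothesis r_cvg : forall e, 0 < e -> exists N, forall n, (N <= n)%N -> r n < e.

(** Truncation at [e0] keeps the argument where [phi] is known to be monotone, so that the sequence
    is nonincreasing from index 0 as [Pd] demands; since the radii tend to 0, the tail is
    unaffected. *)
Definition scaled_radius n : R := phi (Num.min (r n) e0) `^ d%:R^-1.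

Lemma phi_min_ge0 n : 0 <= phi (Num.min (r n) e0).
Proof.
have e00 := sf_e0 hphi.
by apply: (sf_ge0 hphi); rewrite ?le_min ?ge_min ?lexx ?orbT ?(ltW e00) ?(ltW (r_pos n)).
Qed.

Lemma scaled_radius_pow n : scaled_radius n ^+ d = phi (Num.min (r n) e0).
Proof. by rewrite pow_root// phi_min_ge0. Qed.

Lemma scaled_radius_cvg e : 0 < e -> exists N, forall n, (N <= n)%N -> scaled_radius n < e.
Proof.
move=> e_gt0; have [del del0 Hdel] := phi_cvg (exprn_gt0 d e_gt0).
have [N HN] := r_cvg del0; exists N => n Nn.
rewrite ltNge; apply/negP => h.
have : e ^+ d <= scaled_radius n ^+ d by rewrite lerXn2r ?nnegrE ?powR_ge0 ?(ltW e_gt0).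
rewrite scaled_radius_pow leNgt Hdel// ?lt_min ?r_pos ?(sf_e0 hphi)//.
by rewrite gt_min HN.
Qed.

Lemma scaled_radius_Pd : (\sum_(n <oo) (phi (Num.min (r n) e0))%:E = +oo)%E ->
  Pd d scaled_radius.
Proof.
move=> oo; split.
- move=> n; apply: (@le_pow_inv _ d) => //; first exact: powR_ge0.
  rewrite !scaled_radius_pow; apply: (sf_mono hphi).
  + by rewrite le_min (ltW (r_pos _)) (ltW (sf_e0 hphi)).
  + by rewrite le_min !ge_min r_dec lexx orbT.
  + by rewrite ge_min lexx orbT.
- apply/cvgrPdist_lt => e e_gt0; have [N HN] := scaled_radius_cvg e_gt0.
  exists N => // n Nn /=; rewrite sub0r normrN ger0_norm ?powR_ge0//; exact: HN.
- by under eq_eseriesr do rewrite scaled_radius_pow.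
Qed.

End radii.

(** * Integrals against the measure of the radii *)

Section integral.
Variables (R : realType) (d : nat).
Hypothesis d0 : (0 < d)%N.
Local Notation dnorm := (@dnorm R d).

Lemma ratio_inf_fin g (t : R) : gauge g -> 0 < t -> ratio_inf d g t \is a fin_num.
Proof.
move=> gg t0; have := dnorm_fin d gg t; rewrite dnormE//.
have td := powd_gt0 d t0.
have := ratio_inf_ge0 d gg t; case: (ratio_inf d g t) => [s| |]//= _.
by rewrite gt0_muley ?lte_fin.
Qed.

(** On []0, 1]] the function is [t ^+ d] times the nonincreasing function [ratio_inf]; after a sign
    change the upper level sets of the latter are intervals. *)
Lemma measurable_dnorm (g : \bar R -> \bar R) : gauge g ->
  measurable_fun (`]0%R, 1%R]%classic : set R) (fun t : R => dnorm g t%:E).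
Proof.
move=> gg; pose F (t : R) := t ^+ d * fine (ratio_inf d g t).
apply: (eq_measurable_fun (EFin \o F)).
  move=> t; rewrite inE => t01.
  have t0 : 0 < t by move: t01; rewrite /= in_itv/= => /andP[].
  by rewrite dnormE// -[X in (_ * X)%E]fineK ?ratio_inf_fin// -EFinM.
apply/measurable_EFinP; apply: measurable_funM.
  by apply: measurable_funX; exact: measurable_id.
rewrite -[X in measurable_fun _ X]opprK; apply: measurable_funN.
move=> m; move: m; apply: (measurability _ (RGenCInfty.measurableE R)) => _ [_] [s] -> <-.
apply: is_interval_measurable => a b /= [].
rewrite !in_itv/= !andbT => /andP[a0 a1] sa [/andP[b0 b1] sb] u /andP[au ub].
have u0 := lt_le_trans a0 au.
split; first by rewrite /= in_itv/= u0 (le_trans ub b1).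
rewrite /= in_itv/= andbT.
apply: (le_trans sa); rewrite lerN2; apply: fine_le; rewrite ?ratio_inf_fin//.
exact: ratio_inf_anti.
Qed.

Lemma integral_nr g (r : nat -> R) : gauge g -> (forall n, 0 < r n) ->
  (\int[nr r]_(t in `]0%R, 1%R]) dnorm g t%:E =
   \sum_(n <oo) (if (r n <= 1)%R then dnorm g (r n)%:E else 0))%E.
Proof.
move=> gg r0; rewrite /nr ge0_integral_measure_series//; last 2 first.
- by move=> t _; exact: dnorm_ge0.
- exact: measurable_dnorm.
apply: eq_eseriesr => n _; rewrite /nr_meas; case: ifP => rn1.
  rewrite integral_dirac//; last exact: measurable_dnorm.
  by rewrite diracE mem_set ?mul1e//= in_itv/= r0.
exact: integral_measure_zero.
Qed.

End integral.

(** * A strictly larger gauge that is still summable *)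

Section finer_gauge.
Variables (R : realType) (d : nat).
Hypothesis d0 : (0 < d)%N.
Variables (phi : R -> R) (e0 : R).
Hypothesis hphi : scale_fun d phi e0.
Hypothesis phi_ge0 : forall r, 0 <= r -> 0 <= phi r.
Hypothesis phi_cvg : forall e, 0 < e -> exists2 del, 0 < del & forall s, 0 < s -> s < del -> phi s < e.
Variable a : nat -> R.
Hypothesis a_ge0 : forall n, 0 <= a n.
Hypothesis a_sum : (\sum_(n <oo) (a n)%:E < +oo)%E.

Lemma div_succ_le (u : R) (m : nat) : 0 <= u -> u / m.+1%:R *+ m <= u.
Proof.
move=> u0; rewrite -mulr_natr -mulrA -[leRHS]mulr1; apply: ler_wpM2l => //.
by rewrite mulrC ler_pdivrMr// mul1r ler_nat.
Qed.

(** Half of [e] pays for a tail of the series; the finitely many other terms are each cut down to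
    [e / 2 / M.+1]. *)
Lemma truncated_sum (e : R) : 0 < e -> exists2 tau : R, 0 < tau <= e &
  (\sum_(n <oo) (Num.min (a n) tau)%:E <= e%:E)%E.
Proof.
move=> e_gt0; have e2 : 0 < e / 2 by rewrite divr_gt0.
have ae n : (0 <= (a n)%:E)%E by rewrite lee_fin.
have [M HM] := nneseries_tail_lt ae a_sum e2.
pose tau := e / 2 / M.+1%:R.
have t0 : 0 < tau by rewrite divr_gt0.
have me n : (0 <= (Num.min (a n) tau)%:E)%E by rewrite lee_fin le_min a_ge0 ltW.
exists tau.
  rewrite t0/= /tau ler_pdivrMr//.
  have : e * 1 <= e * M.+1%:R by rewrite ler_pM2l// ler1n.
  lra.
rewrite (nneseries_split 0 M)// add0n (splitr e) EFinD; apply: leeD; last first.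
  apply: le_trans (ltW HM); rewrite !ereal_series.
  by apply: lee_nneseries => [n _ _|n _]; [exact: me|rewrite lee_fin ge_min lexx].
rewrite sumEFin lee_fin.
apply: (@le_trans _ _ (\sum_(0 <= i < M) tau)).
  by apply: ler_sum => i _; rewrite ge_min lexx orbT.
rewrite sumr_const_nat subn0; exact: div_succ_le (ltW e2).
Qed.

(** Truncation preserves cross-multiplied monotonicity. With [b1], [b2] powers it gives
    normalization of each truncated term; with values of [phi] it gives monotonicity of the quotient
    by [phi]. *)
Lemma min_cross (a1 a2 b1 b2 t : R) : 0 <= b1 -> 0 <= b2 ->
  b1 * a1 <= b2 * a2 -> b1 * t <= b2 * t -> b1 * Num.min a1 t <= b2 * Num.min a2 t.
Proof.
move=> b10 b20 h1 h2; rewrite [Num.min a2 t]/Order.min; case: ifP => _.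
  by apply: le_trans h1; rewrite ler_wpM2l// ge_min lexx.
by apply: le_trans h2; rewrite ler_wpM2l// ge_min lexx orbT.
Qed.

(** The witness is [\sum_k min phi (tau k)] with [tau] decreasing fast: each term is eventually
    equal to [phi] near [0], so the quotient by [phi] grows to infinity. *)
Lemma finer_gauge : exists h : \bar R -> \bar R, [/\ gauge h, dnormalized d h,
  forall g : \bar R -> \bar R, (forall r, 0 <= r -> r <= e0 -> g r%:E = (phi r)%:E) -> prec h g,
  forall r s, 0 <= r -> r <= s -> s <= e0 -> (h r%:E <= h s%:E)%E &
  forall r : nat -> R, (forall n, 0 < r n) -> (forall n, phi (r n) = a n) ->
    (\sum_(n <oo) h (r n)%:E < +oo)%E].
Proof.
have e00 := sf_e0 hphi.
(* These numbers sum to 1 and bound both the heights [tau k] and the truncated series. *)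
pose e k : R := 1 / (2 ^ k.+1)%:R.
have ek0 k : 0 < e k by rewrite divr_gt0// ltr0n expn_gt0.
have /choice [tau tauP] k : exists tau, 0 < tau <= e k /\
    (\sum_(n <oo) (Num.min (a n) tau)%:E <= (e k)%:E)%E.
  by have [t ? ?] := truncated_sum (ek0 k); exists t.
have tau0 k : 0 < tau k by case: (tauP k) => /andP[].
have taue k : tau k <= e k by case: (tauP k) => /andP[].
pose H r : \bar R := (\sum_(k <oo) (Num.min (phi r) (tau k))%:E)%E.
have me r k : 0 <= r -> (0 <= (Num.min (phi r) (tau k))%:E)%E.
  by move=> r0; rewrite lee_fin le_min phi_ge0//= ltW.
have H0 r : 0 <= r -> (0 <= H r)%E by move=> r0; apply: nneseries_ge0 => k _ _; exact: me.
have taufin : (\sum_(k <oo) (tau k)%:E < +oo)%E.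
  apply: (@le_lt_trans _ _ 1%E); last exact: ltry.
  apply: le_trans (epsilon_trick0 xpredT (@ler01 R)).
  by apply: lee_nneseries => [n _ _|n _]; rewrite lee_fin ?(ltW (tau0 _)).
pose h (u : \bar R) : \bar R := match u with
  | EFin r => if r <= 0 then 0%E else H r | +oo%E => +oo%E | -oo%E => 0%E end.
have hE r : 0 < r -> h r%:E = H r by move=> r0; rewrite /h leNgt r0.
have h00 : h 0%E = 0%E by rewrite /= lexx.
have hmono r s : 0 <= r -> r <= s -> s <= e0 -> (h r%:E <= h s%:E)%E.
  rewrite le_eqVlt => /predU1P[<- s0 _|r0 rs se].
    by rewrite h00 /=; case: (leP s 0) => // s1; exact: H0 (ltW s1).
  have s0 := lt_le_trans r0 rs; rewrite !hE//.
  apply: lee_nneseries => [k _ _|k _]; first exact: me (ltW r0).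
  by rewrite lee_fin le_min !ge_min lexx orbT andbT (sf_mono hphi)// ltW.
have gh : gauge h.
  split => //.
  - by move=> [r| |]//= _; case: (leP r 0) => // s1; exact: H0 (ltW s1).
  - by exists e0.
  - move=> eta eta0; have eta2 : 0 < eta / 2 by rewrite divr_gt0.
    have te k : (0 <= (tau k)%:E)%E by rewrite lee_fin ltW.
    have [K HK] := nneseries_tail_lt te taufin eta2.
    have [del del0 Hdel] := phi_cvg (divr_gt0 eta2 (ltr0Sn R K)).
    exists del => // r r0 rdel; rewrite hE// /H (nneseries_split 0 K); last by move=> k _; exact: me (ltW r0).
    rewrite add0n (splitr eta) EFinD; apply: lee_ltD.
    + by rewrite sumEFin.
    + rewrite sumEFin lee_fin; apply: (@le_trans _ _ (\sum_(0 <= i < K) (eta / 2 / K.+1%:R))).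
        by apply: ler_sum => i _; rewrite ge_min ltW ?Hdel.
      rewrite sumr_const_nat subn0; exact: div_succ_le (ltW eta2).
    + apply: le_lt_trans HK; rewrite !ereal_series.
      by apply: lee_nneseries => [k _ _|k _]; [exact: me (ltW r0)|rewrite lee_fin ge_min lexx orbT].
exists h; split => //.
- exists e0 => // r; rewrite le_eqVlt => /predU1P[<- _|r0 re]; first by rewrite h00 dnorm0.
  apply/eqP; rewrite eq_le dnorm_le ?(ltW r0)// andbT.
  rewrite dnormE// -lee_pdivrMl ?powd_gt0//; apply: ratio_inf_ge => s s0 sr.
  rewrite muleC lee_pdivlMr ?powd_gt0// muleAC lee_pdivrMr ?powd_gt0// !hE// muleC [leRHS]muleC.
  rewrite -!nneseriesZl; [|by move=> k _; exact: me (ltW _)..].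
  apply: lee_nneseries => [k _ _|k _].
    by rewrite mule_ge0 ?me ?(ltW r0)// lee_fin exprn_ge0// ltW.
  rewrite -!EFinM lee_fin.
  have rd := powd_gt0 d r0; have sd := powd_gt0 d s0.
  apply: min_cross; rewrite ?(ltW rd) ?(ltW sd)//.
    by rewrite mulrC [leRHS]mulrC (sf_ratio hphi).
  by rewrite ler_wpM2r ?(ltW (tau0 k))// lerXn2r ?nnegrE ?(ltW s0) ?(ltW r0).
- move=> g gphi; right; exists e0 => //.
  have grat r : 0 < r -> r <= e0 -> eratio (h r%:E) (g r%:E) = (H r * ((phi r)^-1)%:E)%E.
    by move=> r0 re; rewrite gphi ?(ltW r0)// hE.
  have phi0 r : 0 < r -> r <= e0 -> 0 < phi r by move=> ? ?; exact: (sf_gt0 hphi).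
  split=> [r s r0 rs se|M].
    have s0 := lt_le_trans r0 rs; have re := le_trans rs se.
    have pr := phi0 r r0 re; have ps := phi0 s s0 se.
    rewrite !grat// lee_pdivrMr// muleAC lee_pdivlMr// muleC [leRHS]muleC.
    rewrite -!nneseriesZl; [|by move=> k _; exact: me (ltW _)..].
    apply: lee_nneseries => [k _ _|k _].
      by rewrite mule_ge0 ?me ?(ltW s0)// lee_fin ltW.
    rewrite -!EFinM lee_fin; apply: min_cross; rewrite ?(ltW pr) ?(ltW ps)//.
      by rewrite mulrC.
    by rewrite ler_wpM2r ?(ltW (tau0 k))// (sf_mono hphi)// ltW.
  (* Near [0] the first [K] truncations are inactive, so the new gauge is at least [K * phi], which
     exceeds [M * phi]. *)
  pose K := Num.bound `|M|.
  have MK : M < K%:R by apply: le_lt_trans (ler_norm M) (archi_boundP (normr_ge0 M)).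
  have [del del0 Hdel] : exists2 del, 0 < del & forall r, 0 < r -> r < del ->
      forall k, (k < K)%N -> phi r <= tau k.
    elim: K {MK} => [|K [del del0 Hdel]]; first by exists 1.
    have [del' del'0 Hdel'] := phi_cvg (tau0 K).
    exists (Num.min del del'); first by rewrite lt_min del0.
    move=> r r0; rewrite lt_min => /andP[rd rd'] k.
    by rewrite ltnS leq_eqVlt => /predU1P[->|]; [exact/ltW/Hdel'|exact: Hdel].
  exists (Num.min del e0); first by rewrite lt_min del0.
  move=> r r0; rewrite lt_min => /andP[rd re]; have re' := ltW re.
  have pr := phi0 r r0 re'.
  rewrite grat// lte_pdivlMr//.
  apply: (@lt_le_trans _ _ (K%:R * phi r)%:E); first by rewrite -EFinM lte_fin ltr_pM2r.
  apply: (@le_trans _ _ (\sum_(0 <= k < K) (Num.min (phi r) (tau k))%:E)%R); last first.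
    by apply: nneseries_lim_ge => k _ _; exact: me (ltW r0).
  rewrite sumEFin lee_fin big_mkord (eq_bigr (fun=> phi r)).
    by rewrite sumr_const card_ord mulr_natl.
  by move=> k _; rewrite min_l// Hdel.
(* Exchanging the two sums leaves [\sum_k \sum_n min (a n) (tau k)], bounded by the sum of the
   [e k]. *)
- move=> r r0 ra; under eq_eseriesr => n _ do rewrite hE// /H ra.
  rewrite nneseries_interchange; last by move=> i j; rewrite lee_fin le_min a_ge0 ltW.
  apply: (@le_lt_trans _ _ 1%E); last exact: ltry.
  apply: le_trans (epsilon_trick0 xpredT (@ler01 R)).
  apply: lee_nneseries => [k _ _|k _]; last by case: (tauP k).
  by apply: nneseries_ge0 => n _ _; rewrite lee_fin le_min a_ge0 ltW.
Qed.

End finer_gauge.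

(** * Describability *)

Section describability.
Variables (R : realType) (d : nat).
Hypothesis d0 : (0 < d)%N.
Local Notation V := 'rV[R]_d.
Variable nrm : V -> R.
Hypothesis hnrm : is_norm nrm.
Local Notation D := (@cube_diam R d nrm).
Local Notation leb := (@leb_outer R d).
Local Notation rdiam := (@rdiam R d nrm).
Local Notation dnorm := (@dnorm R d).
Variables (U : set V) (x : nat -> V) (r : nat -> R).
Hypothesis oU : open U.
Hypothesis U_neq0 : U !=set0.
Hypothesis hx : unif_eutaxic nrm x U.
Hypothesis r_pos : forall n, 0 < r n.
Hypothesis r_dec : forall n, r n.+1 <= r n.

(** The harmonic series: the [d]-th powers are [c ^+ d / n.+1]. *)
Lemma Pd_below (c : R) : 0 < c -> exists2 s : nat -> R, Pd d s & forall n, s n <= c.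
Proof.
move=> c0; have cd : 0 < c ^+ d by rewrite exprn_gt0.
pose a (n : nat) : R := c ^+ d * harmonic n.
have a0 n : 0 <= a n by rewrite mulr_ge0 ?harmonic_ge0// ltW.
have aE n : (a n `^ d%:R^-1) ^+ d = a n by rewrite pow_root.
exists (fun n => a n `^ d%:R^-1); last first.
  move=> n; apply: (@le_pow_inv _ d d0 _ _ (ltW c0)); rewrite aE /a ger_pMr//.
  by rewrite /harmonic/= invf_le1// ler1n.
split.
- move=> n; apply: (@le_pow_inv _ d d0); first exact: powR_ge0.
  by rewrite !aE /a ler_pM2l// /harmonic/= lef_pV2 ?posrE// ler_nat.
- apply/cvgrPdist_lt => e e0.
  have h : (a n @[n --> \oo] --> 0)%R.
    by rewrite -(mulr0 (c ^+ d)); apply: cvgM; [exact: cvg_cst|exact: cvg_harmonic].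
  have /cvgrPdist_lt /(_ _ (exprn_gt0 d e0)) [N _ HN] := h.
  exists N => // n Nn /=; rewrite sub0r normrN ger0_norm ?powR_ge0// ltNge; apply/negP => en.
  have : e ^+ d <= a n by rewrite -aE lerXn2r ?nnegrE ?powR_ge0// ltW.
  by rewrite leNgt; have := HN n Nn; rewrite /= sub0r normrN ger0_norm// => ->.
- under eq_eseriesr do rewrite aE EFinM.
  rewrite nneseriesZl; last by move=> n _; rewrite lee_fin harmonic_ge0.
  suff -> : (\sum_(n <oo) (harmonic n : R)%:E = +oo)%E by rewrite gt0_muley.
  apply: contrapT => hfin; apply: (@dvg_harmonic R); apply: nnseries_is_cvg.
    by move=> i; exact: harmonic_ge0.
  by rewrite ltey; apply/eqP.
Qed.

Lemma r_noninc n m : (n <= m)%N -> r m <= r n.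
Proof.
elim: m => [|m IH]; first by rewrite leqn0 => /eqP ->.
by rewrite leq_eqVlt => /predU1P[->//|/IH]; exact: le_trans.
Qed.

(** Radii tending to 0 form a sequence in [Pd]. Otherwise they stay above some [c > 0], and eutaxy
    is applied to a sequence of [Pd] below [c], whose balls are smaller. *)
Lemma full_measure : (\sum_(n <oo) ((r n) ^+ d)%:E)%E = +oo%E ->
  leb (U `\` io_ball nrm x r) = 0%E.
Proof.
move=> roo.
have [rc|] := pselect (forall e, 0 < e -> exists N, forall n, (N <= n)%N -> r n < e).
  apply: hx; split => //; apply/cvgrPdist_lt => e e0; have [N HN] := rc e e0.
  by exists N => // n Nn /=; rewrite sub0r normrN ger0_norm ?HN// ltW.
move=> /existsNP [c /not_implyP[c0 /forallNP nc]].
have rc n : c <= r n.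
  have /existsNP [m /not_implyP[nm /negP]] := nc n; rewrite -leNgt => h.
  exact: le_trans h (r_noninc nm).
have [s sP sc] := Pd_below c0.
apply: leb_outerS_eq0 (hx sP) => y [Uy yio]; split => // ys; apply: yio => N.
by have [n Nn yn] := ys N; exists n => //; apply: lt_le_trans yn (le_trans (sc n) (rc n)).
Qed.

Hypothesis r_sum : (\sum_(n <oo) ((r n) ^+ d)%:E < +oo)%E.

Lemma r_cvg (e : R) : 0 < e -> exists N, forall n, (N <= n)%N -> r n < e.
Proof.
move=> e0.
have [|N HN] := nneseries_lt_cvg0 _ r_sum (exprn_gt0 d e0).
  by move=> n; rewrite exprn_ge0// ltW.
exists N => n /HN h; rewrite ltNge; apply/negP => en.
by move: h; rewrite ltNge lerXn2r ?nnegrE// ltW.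
Qed.

Definition dominates (h : \bar R -> \bar R) :=
  exists2 e : R, 0 < e & forall s : R, 0 < s -> s < e -> ((s ^+ d)%:E <= h s%:E)%E.

Lemma rgauge_cvg h (e0 : R) : gauge h -> 0 < e0 ->
  (forall s, 0 <= s -> s <= e0 -> h s%:E = (rgauge h s)%:E) ->
  forall e, 0 < e -> exists2 del, 0 < del & forall s, 0 < s -> s < del -> rgauge h s < e.
Proof.
move=> gh e00 hE e e_gt0; case: (gh) => _ _ /(_ e e_gt0) [del del0 Hdel] _ _.
exists (Num.min del e0); first by rewrite lt_min del0.
move=> s s0; rewrite lt_min => /andP[sdel se].
by rewrite -lte_fin -hE ?(ltW s0) ?(ltW se)// Hdel.
Qed.

(** The comparison series [u] transfers divergence from one gauge to a larger one; its finite terms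
    ensure that divergence survives the truncation of the first radii. *)
Lemma content_lower (h : \bar R -> \bar R) (u : nat -> \bar R) (N : nat) :
  gauge h -> dnormalized d h -> dominates h ->
  (forall n, 0 <= u n)%E -> (forall n, u n \is a fin_num) ->
  (forall n, (N <= n)%N -> (u n <= h (r n)%:E)%E) -> (\sum_(n <oo) u n = +oo)%E ->
  exists e0, [/\ scale_fun d (rgauge h) e0,
    forall s, 0 <= s -> s <= e0 -> h s%:E = (rgauge h s)%:E, (e0%:E < eps_h d h)%E &
    forall (mu : nat -> set V) (L : set V),
      (forall n, dyadic0 (mu n)) -> dyadic L -> L `<=` U -> rdiam L <= e0 ->
      io_ball nrm x r `&` L `<=` \bigcup_n mu n -> (forall n, ~ L `<=` mu n) ->
      (h (diam nrm L) <=
        \sum_(n <oo) (if `[< inside mu L n >] then h (diam nrm (mu n)) else 0))%E].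
Proof.
move=> gh nh domh u0 ufin uh uoo.
have [e0 [_ sf hE he]] := gauge_scale d0 gh nh (@ltr01 R) domh.
have e00 := sf_e0 sf.
exists e0; split => //.
have phic := rgauge_cvg gh e00 hE.
have [N1 HN1] := r_cvg e00.
have rs n : (N1 <= n)%N -> 0 < r n <= e0 by move=> /HN1/ltW ->; rewrite r_pos.
have rrP : Pd d (scaled_radius d (rgauge h) e0 r).
  apply: (scaled_radius_Pd d0 sf phic r_pos r_dec r_cvg).
  apply: (nneseries_shift_oo (N := maxn N N1) u0 _ ufin _ uoo) => n.
    by rewrite lee_fin (phi_min_ge0 sf).
  rewrite geq_max => /andP[Nn N1n]; have /andP[_ rne] := rs n N1n.
  by rewrite min_l// -hE ?uh// ltW.
move=> mu L dmu dL LU Le cov nomu.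
have hL : h (diam nrm L) = (wt nrm (rgauge h) L)%:E.
  rewrite (diam_rdiam d0 hnrm); last by right.
  by apply: hE => //; apply: (rdiam_ge0 d0 hnrm); right.
rewrite hL; apply: le_trans (@full_content _ _ d0 nrm hnrm _ e0 sf U x r
  (scaled_radius d (rgauge h) e0 r) N1 rs _ _ _ (hx rrP) mu L dmu dL LU Le cov nomu) _.
- by move=> n; exact: powR_ge0.
- by move=> n N1n; rewrite (scaled_radius_pow d0 sf r_pos) min_l//; case/andP: (rs n N1n).
- exact: (scaled_radius_cvg d0 sf phic r_pos r_cvg).
apply: lee_nneseries => [n _ _|n _]; case: asboolP => // -[_ nL].
  rewrite lee_fin; apply: (wt_ge0 d0 hnrm sf); split => //.
  by apply: le_trans Le; apply: (le_rdiam d0 hnrm) => //; right.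
have ne : rdiam (mu n) <= e0 by apply: le_trans Le; apply: (le_rdiam d0 hnrm) => //; right.
by rewrite (diam_rdiam d0 hnrm)// hE ?(rdiam_ge0 d0 hnrm).
Qed.

Lemma Ginf_dominates g : Ginf d g -> dominates (dnorm g).
Proof.
move=> Gg; have [del del0 H] := Ginf_dnorm Gg 1; exists del => // s s0 sd.
by have := H s s0 sd; rewrite mul1r.
Qed.

(** The convention for gauges vanishing near [0] cannot occur, as [dnorm g] dominates [s ^+ d]. In
    the other case the quotient eventually exceeds 1. *)
Lemma prec_ge h g : Ginf d g -> prec h (dnorm g) ->
  exists2 e : R, 0 < e & forall s : R, 0 < s -> s < e -> (dnorm g s%:E <= h s%:E)%E.
Proof.
move=> Gg [[e e0 ge]|[e e0 [_ /(_ 1) [del del0 Hdel]]]].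
  have [e' e'0 H] := Ginf_dominates Gg.
  pose s := Num.min e (e' / 2).
  have s0 : 0 < s by rewrite lt_min e0 divr_gt0.
  have se' : s < e' by rewrite gt_min ltr_pdivrMr// ltr_pMr// ltr1n orbT.
  have := H s s0 se'; rewrite ge ?(ltW s0)//; last by rewrite ge_min lexx.
  by rewrite lee_fin leNgt exprn_gt0.
have [e' e'0 H] := Ginf_dominates Gg.
exists (Num.min del e'); first by rewrite lt_min del0.
move=> s s0; rewrite lt_min => /andP[sd se'].
have := Hdel s s0 sd; have := H s s0 se'.
have := dnorm_fin d (proj1 Gg) s; case: (dnorm g s%:E) => // b _.
rewrite lee_fin => sb; have b0 : 0 < b by apply: lt_le_trans sb; rewrite exprn_gt0.
by rewrite /eratio lte_pdivlMr// mul1e => /ltW.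
Qed.

(** Only finitely many radii exceed 1, and they contribute finite terms. *)
Lemma Gn_sum g : Ginf d g -> Gn d (nr r) g <-> (\sum_(n <oo) dnorm g (r n)%:E = +oo)%E.
Proof.
move=> Gg; have gg := proj1 Gg.
have [N HN] := r_cvg (@ltr01 R).
pose v n : \bar R := if r n <= 1 then dnorm g (r n)%:E else 0%E.
have v0 n : (0 <= v n)%E by rewrite /v; case: ifP => // _; exact: dnorm_ge0.
have u0 n : (0 <= dnorm g (r n)%:E)%E by exact: dnorm_ge0.
have vu n : (N <= n)%N -> v n = dnorm g (r n)%:E by move=> /HN/ltW h; rewrite /v h.
have vE := integral_nr d gg r_pos; split => [[_]|oo].
  rewrite vE; apply: (nneseries_shift_oo (N := N)) => // n; last by move=> /vu; rewrite /v => ->.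
  by case: ifP => // _; exact: dnorm_fin.
split => //; rewrite vE; apply: (nneseries_shift_oo (N := N)) oo => // n.
  exact: dnorm_fin.
by move=> /vu; rewrite /v => ->.
Qed.

End describability.

(** * Dyadic contents of open sets and of their traces *)

Section contents.
Variables (R : realType) (d : nat).
Hypothesis d0 : (0 < d)%N.
Local Notation V := 'rV[R]_d.
Variable nrm : V -> R.
Hypothesis hnrm : is_norm nrm.
Local Notation D := (@cube_diam R d nrm).
Local Notation leb := (@leb_outer R d).
Local Notation rdiam := (@rdiam R d nrm).
Local Notation dnorm := (@dnorm R d).
Implicit Types (h g : \bar R -> \bar R).

Lemma gauge_diam_ge0 h (C : set V) : gauge h -> (0 <= h (diam nrm C))%E.
Proof. by case=> + _ _ _ _; apply; exact: diam_ge0. Qed.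

Lemma gauge_diam_set0 h : gauge h -> h (diam nrm set0) = 0%E.
Proof. by rewrite diam_set0; case. Qed.

Lemma open_cell (G : set V) (y : V) (e : R) : open G -> G y -> 0 < e ->
  exists2 j0 : int, D * 2 ^ (- j0) < e & forall j, j0 <= j -> cell j y `<=` G.
Proof.
move=> oG Gy e0; have D0 := cube_diam_gt0 d0 hnrm.
have [del del0 Hdel] := (open_coordP G).1 oG y Gy.
pose s := Num.min e (D * del).
have s0 : 0 < s by rewrite lt_min e0 mulr_gt0.
have [j0 /andP[j1 _]] := dyadic_scale d0 hnrm s0.
have [je jd] : D * 2 ^ (- j0) < e /\ D * 2 ^ (- j0) < D * del.
  by move: j1; rewrite lt_min => /andP[].
exists j0 => // j j0j z zy; apply: Hdel => i.
apply: (@lt_le_trans _ _ (2 ^ (- j))); first exact: (@cell_coord _ _ j y).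
apply: (@le_trans _ _ (2 ^ (- j0))); first by rewrite ler_pow2.
by move: jd; rewrite ltr_pM2l// => /ltW.
Qed.

Lemma eps_h_mono h (a b : R) : 0 <= a -> a <= b -> (b%:E < eps_h d h)%E ->
  (h a%:E <= h b%:E)%E.
Proof.
move=> a0 ab /ereal_sup_gt [_ [e [_ [mono _]] <-]]; rewrite lte_fin => be.
by apply: mono => //; exact: ltW.
Qed.

Lemma Mh_le h (A B : set V) : A `<=` B -> (Mh nrm h A <= Mh nrm h B)%E.
Proof.
move=> AB; apply: ereal_inf_le_tmp => _ [lam [cov hl] <-]; exists lam => //; split => //.
exact: subset_trans cov.
Qed.

Lemma Mh_gt0 h (W : set V) (e0 : R) : open W -> W !=set0 -> gauge h ->
  scale_fun d (rgauge h) e0 -> (forall s, 0 <= s -> s <= e0 -> h s%:E = (rgauge h s)%:E) ->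
  (0 < Mh nrm h W)%E.
Proof.
move=> oW [w Ww] gh sf hE; have e00 := sf_e0 sf.
have [j je jW] := open_cell oW Ww e00.
pose L := cell j w; have dL : dyadic L by exact: dyadic_cell.
have LW : L `<=` W by exact: jW.
have Le : rdiam L <= e0 by rewrite rdiam_cell// ltW.
have rL0 := rdiam_gt0 d0 hnrm dL.
have wL : h (diam nrm L) = (wt nrm (rgauge h) L)%:E.
  by rewrite (diam_rdiam d0 hnrm) ?hE ?(ltW rL0)//; right.
apply: (@lt_le_trans _ _ (h (diam nrm L))).
  by rewrite wL lte_fin; apply: (sf_gt0 sf).
apply: le_ereal_inf_tmp => _ [mu [cov hmu] <-].
have dmu n : dyadic0 (mu n) by case: (hmu n).
(* A covering cube may be larger than [e0], but stays below [eps_h], where [h] is still monotone;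
   without such a cube around [L], [mass] gives the bound. *)
have [[n Ln]|nomu] := pselect (exists n, L `<=` mu n).
  apply: le_trans (nneseries_term n (fun n => gauge_diam_ge0 (mu n) gh)).
  have dL0 : dyadic0 L by right.
  have [_] := hmu n; rewrite !(diam_rdiam d0 hnrm)//.
  by apply: eps_h_mono; [exact: ltW|apply: (le_rdiam d0 hnrm) => //; right].
rewrite wL; apply: le_trans (@mass _ _ d0 nrm hnrm _ e0 sf mu L dmu dL Le _ _) _.
- by apply: leb_outerS_eq0 (leb_outer_set0 _ d0) => // y [Ly []]; exact/cov/LW.
- by move=> n Ln; apply: nomu; exists n.
have ne n : inside mu L n -> rdiam (mu n) <= e0.
  by move=> [_ nL]; apply: le_trans Le; apply: (le_rdiam d0 hnrm) => //; right.
apply: lee_nneseries => [n _ _|n _].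
  by case: asboolP => // ins; rewrite lee_fin; apply: (wt_ge0 d0 hnrm sf); split => //; exact: ne.
case: asboolP => [ins|_]; last exact: gauge_diam_ge0.
by rewrite (diam_rdiam d0 hnrm)// hE ?(rdiam_ge0 d0 hnrm)//; exact: ne.
Qed.

(** Replacing the members of a cover that lie in a maximal cell of [W] by that cell does not
    increase the weight. *)
Lemma Mh_full h (F W : set V) (e0 : R) : open W -> gauge h ->
  scale_fun d (rgauge h) e0 -> (forall s, 0 <= s -> s <= e0 -> h s%:E = (rgauge h s)%:E) ->
  (e0%:E < eps_h d h)%E ->
  (forall (mu : nat -> set V) (L : set V),
      (forall n, dyadic0 (mu n)) -> dyadic L -> L `<=` W -> rdiam L <= e0 ->
      F `&` L `<=` \bigcup_n mu n -> (forall n, ~ L `<=` mu n) ->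
      (h (diam nrm L) <=
        \sum_(n <oo) (if `[< inside mu L n >] then h (diam nrm (mu n)) else 0))%E) ->
  Mh nrm h (F `&` W) = Mh nrm h W.
Proof.
move=> oW gh sf hE he content; have e00 := sf_e0 sf.
apply/eqP; rewrite eq_le Mh_le//=.
apply: le_ereal_inf_tmp => _ [mu [cov hmu] <-].
have dmu n : dyadic0 (mu n) by case: (hmu n).
have [J0 /andP[J0e _]] := dyadic_scale d0 hnrm e00.
pose Q := max_cell (fun B : set V => B `<=` W) J0.
have QP B : Q B -> [/\ dyadic B, B `<=` W & rdiam B <= e0].
  move=> [n [y [-> BW _]]]; split => //; first exact: dyadic_cell.
  rewrite rdiam_cell// ltW//; apply: le_lt_trans J0e.
  by rewrite ler_pM2l ?cube_diam_gt0// ler_pow2 lerDl.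
(* Maximal cells already inside a member of the cover need no replacement. *)
pose Qh B := Q B /\ forall n, ~ B `<=` mu n.
pose cond n := exists B, Qh B /\ inside mu B n.
have hd0 n : (0 <= h (diam nrm (mu n)))%E by exact: gauge_diam_ge0.
pose a n := if `[< cond n >] then h (diam nrm (mu n)) else 0%E.
pose b n := if `[< cond n >] then 0%E else h (diam nrm (mu n)).
have [lam [lamQ Qlam lamsum]] : exists lam : nat -> set V,
    [/\ forall n, lam n = set0 \/ Qh (lam n) /\ inside mu (lam n) n,
        forall B, Qh B -> exists n, lam n = B &
        (\sum_(n <oo) h (diam nrm (lam n)) <= \sum_(n <oo) a n)%E].
  apply: (@grouping _ _ mu Qh (fun B => h (diam nrm B)) a).
  - by move=> n; rewrite /a; case: ifP.
  - exact: gauge_diam_set0.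
  - move=> B [QB Bmu]; have [dB BW Be] := QP B QB; split.
      rewrite (diam_rdiam d0 hnrm); last by right.
      have rB := rdiam_gt0 d0 hnrm dB.
      by rewrite hE ?(ltW rB)// lte_fin (sf_gt0 sf).
    apply: le_trans (content mu B dmu dB BW Be _ Bmu) _.
      by apply: subset_trans cov => y [Fy /BW Wy]; split.
    apply: lee_nneseries => [n _ _|n _]; case: asboolP => // Bn.
    by rewrite /a asboolT//; exists B; split => //; split.
  - by move=> B B' [QB _] [QB' _]; exact: (max_cell_disj QB QB').
pose nu n := if `[< cond n >] then lam n else mu n.
apply: ge_ereal_inf; exists (\sum_(n <oo) h (diam nrm (nu n)))%E.
  exists nu => //; split; last first.
    move=> n; rewrite /nu; case: asboolP => _; last exact: hmu.
    case: (lamQ n) => [->|[[/QP[dB _ Be] _] _]].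
      by split; [left|rewrite diam_set0; apply: lt_trans he; rewrite lte_fin].
    split; first by right.
    rewrite (diam_rdiam d0 hnrm); last by right.
    by apply: le_lt_trans he; rewrite lee_fin.
  move=> w Ww; have [j0 _ jW] := open_cell oW Ww e00.
  have [B QB jB] : exists2 B, Q B & cell (Num.max J0 j0) w `<=` B.
    apply: max_cell_exists; first by rewrite le_max lexx.
    by apply: jW; rewrite le_max lexx orbT.
  have Bw : B w by exact: jB.
  have [[n Bn]|nomu] := pselect (exists n, B `<=` mu n).
    (* Such a [mu n] is never replaced: lying inside some [B'] of [Qh], it would force [B = B'],
       although [B'] is contained in no [mu n]. *)
    exists n => //; rewrite /nu; case: asboolP => [[B' [[QB' B'mu] [_ nB']]]|_]; last exact: Bn.
    have BB' : B = B'.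
      by apply: (max_cell_disj QB QB'); exists w; split => //; exact/nB'/Bn.
    by case: (B'mu n); rewrite -BB'.
  have QhB : Qh B by split => // n Bn; apply: nomu; exists n.
  have [n lamn] := Qlam B QhB; exists n => //.
  have cn : cond n.
    case: (lamQ n) => [l0|[Ql ins]]; last by exists (lam n).
    by move: Bw; rewrite -lamn l0.
  by rewrite /nu asboolT// lamn.
apply: (@le_trans _ _ (\sum_(n <oo) (h (diam nrm (lam n)) + b n))%E).
  apply: lee_nneseries => [n _ _|n _]; first exact: gauge_diam_ge0.
  rewrite /nu /b; case: asboolP => _; first by rewrite adde0.
  by rewrite leeDr// gauge_diam_ge0.
have b0 n : (0 <= b n)%E by rewrite /b; case: ifP.
have a0 n : (0 <= a n)%E by rewrite /a; case: ifP.
rewrite nneseriesD; [|by move=> n _ _; exact: gauge_diam_ge0|by move=> n _ _; exact: b0].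
apply: (@le_trans _ _ (\sum_(n <oo) a n + \sum_(n <oo) b n)%E); first exact: leeD.
rewrite -nneseriesD//; apply: lee_nneseries => [n _ _|n _]; first exact: adde_ge0.
by rewrite /a /b; case: ifP => _; rewrite ?adde0 ?add0e.
Qed.

End contents.

Lemma nneseries_tail_le (R : realType) (u : nat -> \bar R) (N M : nat) :
  (forall n, 0 <= u n)%E -> (N <= M)%N ->
  (\sum_(M <= n <oo) u n <= \sum_(N <= n <oo) u n)%E.
Proof.
move=> u0 NM; rewrite [leLHS]ereal_series [leRHS]ereal_series.
rewrite [leLHS]eseries_mkcond [leRHS]eseries_mkcond.
apply: lee_nneseries => [n _ _|n _]; first by case: ifP.
by case: (leqP M n) => h; [rewrite (leq_trans NM h)|case: ifP].
Qed.

(** * The majorizing and minorizing collections *)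

Section describable_io_ball.
Variables (R : realType) (d : nat).
Hypothesis d0 : (0 < d)%N.
Local Notation V := 'rV[R]_d.
Variable nrm : V -> R.
Hypothesis hnrm : is_norm nrm.
Local Notation D := (@cube_diam R d nrm).
Local Notation rdiam := (@rdiam R d nrm).
Local Notation dnorm := (@dnorm R d).
Variables (U : set V) (x : nat -> V) (r : nat -> R).
Hypothesis oU : open U.
Hypothesis U_neq0 : U !=set0.
Hypothesis hx : unif_eutaxic nrm x U.
Hypothesis r_pos : forall n, 0 < r n.
Hypothesis r_dec : forall n, r n.+1 <= r n.
Hypothesis r_sum : (\sum_(n <oo) ((r n) ^+ d)%:E < +oo)%E.
Implicit Types (h g : \bar R -> \bar R).

Lemma io_ball_tail N :
  io_ball nrm x r `<=` \bigcup_n [set y | nrm (y - x (n + N)%N) < r (n + N)%N].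
Proof. by move=> y /(_ N) [n Nn yn]; exists (n - N)%N => //=; rewrite subnK. Qed.

Lemma dnorm_sum_fin g : Ginf d g -> ~ Gn d (nr r) g -> (\sum_(n <oo) dnorm g (r n)%:E < +oo)%E.
Proof.
move=> Gg nG; rewrite ltey; apply/eqP => oo; apply: nG.
exact: ((Gn_sum r_pos r_sum Gg).2 oo).
Qed.

Lemma content_dnorm g : Ginf d g -> Gn d (nr r) g -> forall h, gauge h -> dnormalized d h ->
  (exists2 e : R, 0 < e & forall s : R, 0 < s -> s < e -> (dnorm g s%:E <= h s%:E)%E) ->
  exists e0, [/\ scale_fun d (rgauge h) e0,
    forall s, 0 <= s -> s <= e0 -> h s%:E = (rgauge h s)%:E, (e0%:E < eps_h d h)%E &
    forall (mu : nat -> set V) (L : set V),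
      (forall n, dyadic0 (mu n)) -> dyadic L -> L `<=` U -> rdiam L <= e0 ->
      io_ball nrm x r `&` L `<=` \bigcup_n mu n -> (forall n, ~ L `<=` mu n) ->
      (h (diam nrm L) <=
        \sum_(n <oo) (if `[< inside mu L n >] then h (diam nrm (mu n)) else 0))%E].
Proof.
move=> Gg Gng h gh nh [e e_gt0 gle].
have [N HN] := r_cvg r_pos r_sum e_gt0.
apply: (@content_lower _ _ d0 nrm hnrm U x r hx r_pos r_dec r_sum h (fun n => dnorm g (r n)%:E) N) => //.
- have [e1 e10 H] := Ginf_dominates Gg; exists (Num.min e e1); first by rewrite lt_min e_gt0.
  move=> s s0; rewrite lt_min => /andP[se se1].
  by apply: le_trans (gle s s0 se); exact: H.
- by move=> n; apply: dnorm_ge0; case: Gg.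
- by move=> n; apply: dnorm_fin; case: Gg.
- by move=> n /HN; exact: gle.
- exact: ((Gn_sum r_pos r_sum Gg).1 Gng).
Qed.

Lemma Gn_Min g : Gn d (nr r) g -> Min nrm (io_ball nrm x r) U g.
Proof.
move=> Gng; have Gg : Ginf d g by case: Gng.
split; first by case: (Gg) => gg eg; split => //; rewrite eg.
exists (io_ball nrm x r) => //; split; first exact: Gdelta_io_ball.
move=> h gh nh /(prec_ge Gg) hg W oW WU.
have [e0 [sf hE he content]] := content_dnorm Gg Gng gh nh hg.
apply: (Mh_full d0 hnrm oW gh sf hE he) => mu L dmu dL LW.
by apply: content => //; exact: subset_trans WU.
Qed.

(** If the series converged, [finer_gauge] would give [h] with [prec h (dnorm g)] and [h] summable
    over the radii. Tails of the balls then make the content of the trace on [U] zero, whereas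
    [large_int] equates it with the positive content of [U]. *)
Lemma Min_Gn g : Ginf d g -> Min nrm (io_ball nrm x r) U g -> Gn d (nr r) g.
Proof.
move=> Gg [_ [F' [_ Fint] F'F]]; apply: contrapT => nG.
have gg : gauge g by case: Gg.
have gsum := dnorm_sum_fin Gg nG.
have [e0 [_ sf gE _]] := gauge_scale d0 (gauge_dnorm d gg) (dnormalized_dnorm d g)
  (@ltr01 R) (Ginf_dominates Gg).
have e00 := sf_e0 sf.
pose phi := rgauge (dnorm g).
have phiE s : dnorm g s%:E = (phi s)%:E by rewrite /phi /rgauge fineK// dnorm_fin.
have phi0 s : 0 <= s -> 0 <= phi s by move=> s0; rewrite -lee_fin -phiE dnorm_ge0.
have phic := rgauge_cvg (gauge_dnorm d gg) e00 gE.
have asum : (\sum_(n <oo) (phi (r n))%:E < +oo)%E.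
  by under eq_eseriesr do rewrite -phiE.
have [h [gh nh hprec hmono hsum]] := finer_gauge sf phi0 phic
  (fun n => phi0 _ (ltW (r_pos n))) asum.
have {hprec} hg := hprec (dnorm g) (fun s s0 se => gE s s0 se).
have [e2 e20 hge] := prec_ge Gg hg.
have domh : dominates d h.
  have [e3 e30 H] := Ginf_dominates Gg; exists (Num.min e2 e3); first by rewrite lt_min e20.
  move=> s s0; rewrite lt_min => /andP[se2 se3].
  by apply: le_trans (hge s s0 se2); exact: H.
have [e1 [e1e0 sfh hE he]] := gauge_scale d0 gh nh e00 domh.
have e10 := sf_e0 sfh.
have := Fint h gh nh hg U oU (@subset_refl _ U) => MhE.
have := Mh_gt0 d0 hnrm oU U_neq0 gh sfh hE; rewrite -MhE ltNge => /negP; apply.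
have [C C0 HC] := cover_sum d0 hnrm.
apply/lee_addgt0Pr => e e_gt0; rewrite add0e.
have h_ge0 n : (0 <= h (r n)%:E)%E by apply: (gauge_ge0 gh); exact: ltW.
have [N1 HN1] := nneseries_tail_lt h_ge0 (hsum r r_pos (fun=> erefl)) (divr_gt0 e_gt0 C0).
have [N2 HN2] := r_cvg r_pos r_sum e10.
pose N := maxn N1 N2.
have rN n : r (n + N)%N <= e1.
  by apply/ltW/HN2; rewrite (leq_trans (leq_maxr N1 N2))// leq_addl.
have [|E [Ed Ecov Esum]] := HC h e1 (fun n => x (n + N)%N) (fun n => r (n + N)%N)
  (fun n => r (n + N)%N) gh (fun a b a0 ab be => hmono a b a0 ab (le_trans be e1e0)).
  by move=> n; split.
apply: ge_ereal_inf; exists (\sum_(k <oo) h (diam nrm (E k)))%E.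
  exists E => //; split.
    by move=> y [F'y _]; apply: Ecov; exact/io_ball_tail/F'F.
  move=> k; case: (Ed k) => [->|[dE [n En]]].
    by split; [left|rewrite diam_set0; apply: lt_trans he; rewrite lte_fin].
  split; first by right.
  rewrite (diam_rdiam d0 hnrm); last by right.
  by apply: lt_trans he; rewrite lte_fin (lt_le_trans En).
apply: (le_trans Esum).
under eq_eseriesr => n _ do rewrite divff ?gt_eqF// expr1n mulr1.
rewrite nneseriesZl// (nneseries_addn (f := fun n => h (r n)%:E))//.
apply: (@le_trans _ _ (C%:E * (e / C)%:E)%E).
  rewrite lee_pmul2l ?lte_fin//; apply: le_trans (ltW HN1).
  exact: nneseries_tail_le (leq_maxl N1 N2).
by rewrite -EFinM lee_fin mulrC divfK// gt_eqF.
Qed.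

Lemma hausdorff_delta_ge0 g (del : R) (E : set V) : gauge g -> (0 <= hausdorff_delta nrm g del E)%E.
Proof.
move=> gg; apply: le_ereal_inf_tmp => _ [C _ <-]; apply: nneseries_ge0 => n _ _.
exact: gauge_diam_ge0.
Qed.

Lemma hausdorff_null g : Ginf d g -> ~ Gn d (nr r) g ->
  hausdorff nrm g (io_ball nrm x r `&` U) = 0%E.
Proof.
move=> Gg nG; have gg : gauge g by case: Gg.
have gsum := dnorm_sum_fin Gg nG.
case: (gg) => _ [eg eg0 gmono] _ _ _.
have [ed ed0 Hed] := Ginf_dominates Gg.
have [C C0 HC] := cover_sum d0 hnrm.
apply/eqP; rewrite eq_le; apply/andP; split; last first.
  apply: le_trans (hausdorff_delta_ge0 1 (io_ball nrm x r `&` U) gg) _.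
  by apply: ereal_sup_ubound; exists 1 => //=; rewrite in_itv/= ltr01.
apply: ge_ereal_sup => _ [del del_pos <-].
have del0 : 0 < del by move: del_pos; rewrite /= in_itv/= andbT.
apply/lee_addgt0Pr => e e_gt0; rewrite add0e.
have g_ge0 n : (0 <= dnorm g (r n)%:E)%E by exact: dnorm_ge0.
have C20 : 0 < C * 2 by rewrite mulr_gt0.
have [N1 HN1] := nneseries_tail_lt g_ge0 gsum (divr_gt0 e_gt0 C20).
pose m := Num.min (Num.min del eg) ed.
have m0 : 0 < m by rewrite !lt_min del0 eg0 ed0.
have [mdel [meg med]] : m <= del /\ m <= eg /\ m <= ed by rewrite !ge_min !lexx !orbT.
have [N2 HN2] := r_cvg r_pos r_sum m0.
pose N := maxn N1 N2.
have rN n : r (n + N)%N < m.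
  by apply/HN2; rewrite (leq_trans (leq_maxr N1 N2))// leq_addl.
(* Since [g] may exceed [dnorm g] at the radius itself, the ball is cut into cubes of a smaller size
   [rho], where [g rho / rho ^+ d] is within a factor 2 of its infimum. The infimum is positive, so
   such a size exists. *)
have /choice [rho rhoP] n : exists rho, [/\ 0 < rho, rho <= r (n + N)%N &
    ((C * (r (n + N)%N / rho) ^+ d)%:E * g rho%:E <= (C * 2)%:E * dnorm g (r (n + N)%N)%:E)%E].
  set s := r (n + N)%N; have s0 : 0 < s by exact: r_pos.
  have sd := powd_gt0 d s0.
  have qfin := ratio_inf_fin d gg s0.
  have q0 : (0 < ratio_inf d g s)%E.
    rewrite -(@lte_pmul2l _ (s ^+ d)%:E) ?lte_fin// mule0 -dnormE//.
    apply: (@lt_le_trans _ _ (s ^+ d)%:E); first by rewrite lte_fin.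
    by apply: Hed => //; apply: lt_le_trans (rN n) med.
  have : (ratio_inf d g s < 2%:E * ratio_inf d g s)%E.
    rewrite -(fineK qfin) -EFinM lte_fin ltr_pMl ?ltr1n//.
    by rewrite -lte_fin fineK.
  move=> /ereal_inf_lt [_ [rho rho_in <-] Hrho].
  have [rho0 rhos] : 0 < rho /\ rho <= s by move: rho_in; rewrite /= in_itv/= => /andP[].
  exists rho; split => //.
  have -> : ((C * 2)%:E * dnorm g s%:E = C%:E * ((s ^+ d)%:E * (2%:E * ratio_inf d g s)))%E.
    by rewrite dnormE// EFinM -muleA; congr (_ * _)%E; exact: muleCA.
  rewrite expr_div_n EFinM -muleA lee_pmul2l ?lte_fin// EFinM -muleA lee_pmul2l ?lte_fin// muleC.
  exact: ltW.
have [|E [Ed Ecov Esum]] := HC g eg (fun n => x (n + N)%N) (fun n => r (n + N)%N) rho gg gmono.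
  move=> n; have [? ? _] := rhoP n; split => //.
  by apply: le_trans meg; apply: le_trans (ltW (rN n)).
apply: ge_ereal_inf; exists (\sum_(k <oo) g (diam nrm (E k)))%E.
  exists E => //; split.
    by move=> y [Fy _]; apply: Ecov; exact: io_ball_tail.
  move=> k; case: (Ed k) => [->|[dE [n En]]]; first by rewrite diam_set0 lee_fin ltW.
  rewrite (diam_rdiam d0 hnrm); last by right.
  have [_ h1 _] := rhoP n.
  by rewrite lee_fin (le_trans (ltW En))// (le_trans h1)// (le_trans (ltW (rN n))).
apply: (le_trans Esum).
apply: (@le_trans _ _ (\sum_(n <oo) ((C * 2)%:E * dnorm g (r (n + N)%N)%:E))%E).
  apply: lee_nneseries => [n _ _|n _]; last by case: (rhoP n).
  have [h1 h2 _] := rhoP n; rewrite mule_ge0 ?(gauge_ge0 gg) ?(ltW h1)// lee_fin.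
  by rewrite mulr_ge0 ?(ltW C0)// exprn_ge0// divr_ge0 ?(ltW h1)// ltW.
rewrite nneseriesZl// (nneseries_addn (f := fun n => dnorm g (r n)%:E))//.
apply: (@le_trans _ _ ((C * 2)%:E * (e / (C * 2))%:E)%E).
  rewrite lee_pmul2l ?lte_fin//; apply: le_trans (ltW HN1).
  exact: nneseries_tail_le (leq_maxl N1 N2).
by rewrite -EFinM lee_fin mulrC divfK// gt_eqF.
Qed.

(** An arbitrary fine cover is turned into a dyadic one at the cost of a factor [C * 2 ^+ d], and
    [dnorm g <= g]. A cover of small enough total would then contradict the content bound on a cube
    inside [U]. *)
Lemma hausdorff_neq0 g : Gn d (nr r) g -> hausdorff nrm g (io_ball nrm x r `&` U) <> 0%E.
Proof.
move=> Gng H0; have Gg : Ginf d g by case: Gng.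
have gg : gauge g by case: Gg.
have gd := gauge_dnorm d gg; have nd := dnormalized_dnorm d g.
have [|e0 [sf hE he content]] := content_dnorm Gg Gng gd nd.
  by exists 1.
have e00 := sf_e0 sf.
have phic := rgauge_cvg gd e00 hE.
have [C C0 HC] := cover_sum d0 hnrm.
have [u Uu] := U_neq0.
have [j je jU] := open_cell d0 hnrm oU Uu e00.
pose L := cell j u; have dL : dyadic L by exact: dyadic_cell.
have LU : L `<=` U by exact: jU.
have Le : rdiam L <= e0 by rewrite rdiam_cell// ltW.
have rL0 := rdiam_gt0 d0 hnrm dL.
pose w := wt nrm (rgauge (dnorm g)) L.
have w0 : 0 < w by apply: (sf_gt0 sf).
have wE : dnorm g (diam nrm L) = w%:E.
  by rewrite (diam_rdiam d0 hnrm) ?hE ?(ltW rL0)//; right.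
have C20 : 0 < C * 2 ^+ d by rewrite mulr_gt0// exprn_gt0.
(* Cover and corrections [q] each contribute at most [eta]; the total [C * 2 ^+ d * (eta + eta)]
   equals [w / 2], which is less than [w]. *)
pose eta := w / (C * 2 ^+ d) / 4.
have eta0 : 0 < eta by rewrite !divr_gt0.
have : (hausdorff_delta nrm g e0 (io_ball nrm x r `&` U) < eta%:E)%E.
  apply: (@le_lt_trans _ _ 0%E); last by rewrite lte_fin.
  by rewrite -H0; apply: ereal_sup_ubound; exists e0 => //=; rewrite in_itv/= e00.
move=> /ereal_inf_lt [_ [A [Acov Ae] <-] Asum].
have Afin n : diam nrm (A n) = (fine (diam nrm (A n)))%:E.
  rewrite fineK// ge0_fin_numE ?diam_ge0//; apply: le_lt_trans (Ae n) _; exact: ltry.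
pose t n := fine (diam nrm (A n)).
have t0 n : 0 <= t n by rewrite -lee_fin -Afin diam_ge0.
have te n : t n <= e0 by rewrite -lee_fin -Afin.
pose q (n : nat) : R := eta / (2 ^ n.+1)%:R.
have q0 n : 0 < q n by rewrite divr_gt0// ltr0n expn_gt0.
(* Members of diameter 0 still need cubes of positive size; [tau n] supplies one of negligible
   weight. *)
have /choice [tau tauP] n : exists tau, [/\ 0 < tau, tau <= e0 & rgauge (dnorm g) tau < q n].
  have [del del0 Hdel] := phic _ (q0 n).
  exists (Num.min e0 (del / 2)); rewrite lt_min e00 divr_gt0// ge_min lexx; split => //.
  apply: Hdel; first by rewrite lt_min e00 divr_gt0.
  by rewrite gt_min ltr_pdivrMr// ltr_pMr// ltr1n orbT.
pose rho n := Num.max (t n) (tau n).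
have rho0 n : 0 < rho n by rewrite lt_max; have [-> _ _] := tauP n; rewrite orbT.
have rhoe n : rho n <= e0 by rewrite ge_max te; have [_ -> _] := tauP n.
(* The factor 2 turns the bound [nrm (y - c) <= t n] into the strict inequality of an open ball. *)
have /choice [c cP] n : exists c, A n `<=` [set y | nrm (y - c) < 2 * rho n].
  have [[c Ac]|h] := pselect (A n !=set0); last first.
    by exists 0 => y Ay; case: h; exists y.
  exists c => y Ay /=; apply: (@le_lt_trans _ _ (t n)).
    by rewrite -lee_fin -Afin; exact: diam_ge.
  by rewrite (@le_lt_trans _ _ (rho n)) ?le_max ?lexx// ltr_pMl// ltr1n.
have gdmono a b : 0 <= a -> a <= b -> b <= e0 -> (dnorm g a%:E <= dnorm g b%:E)%E.
  move=> a0 ab be; rewrite !hE ?(le_trans a0)// ?(le_trans ab)// lee_fin.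
  exact: (sf_mono sf).
have [|E [Ed Ecov Esum]] := HC (dnorm g) e0 c (fun n => 2 * rho n) rho gd gdmono.
  move=> n; split => //; have := rho0 n; lra.
have dE k : dyadic0 (E k) by case: (Ed k) => [->|[]]; [left|right].
have gE0 k : (0 <= dnorm g (diam nrm (E k)))%E by exact: gauge_diam_ge0.
have lower : (w%:E <= \sum_(k <oo) dnorm g (diam nrm (E k)))%E.
  have [[k Lk]|nE] := pselect (exists k, L `<=` E k).
    apply: le_trans (nneseries_term k gE0); rewrite -wE.
    have dL0 : dyadic0 L by right.
    rewrite !(diam_rdiam d0 hnrm)//; apply: gdmono; first exact: ltW.
      exact: (le_rdiam d0 hnrm).
    case: (Ed k) => [E0|[_ [n En]]]; last exact: le_trans (ltW En) (rhoe n).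
    by rewrite E0 rdiam_set0 ltW.
  rewrite -wE; apply: le_trans (content E L dE dL LU Le _ _) _.
  - move=> y [Fy Ly]; apply: Ecov; have [n _ An] := Acov y (conj Fy (LU y Ly)).
    by exists n => //; exact: cP.
  - by move=> k Lk; apply: nE; exists k.
  by apply: lee_nneseries => [n _ _|n _]; case: ifP.
have := le_trans lower Esum; rewrite leNgt => /negP; apply.
apply: (@le_lt_trans _ _ ((C * 2 ^+ d)%:E * \sum_(n <oo) (g (diam nrm (A n)) + (q n)%:E))%E).
  rewrite -nneseriesZl; last by move=> n _; rewrite adde_ge0 ?gauge_diam_ge0// lee_fin ltW.
  apply: lee_nneseries => [n _ _|n _].
    rewrite mule_ge0 ?dnorm_ge0// lee_fin mulr_ge0 ?(ltW C0)// exprn_ge0//.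
    by rewrite divr_ge0 ?mulr_ge0 ?(ltW (rho0 n)).
  rewrite mulfK ?gt_eqF// lee_pmul2l ?lte_fin//.
  have [tau0 taue tauq] := tauP n.
  rewrite /rho; case: (leP (t n) (tau n)) => _.
    apply: (@le_trans _ _ (q n)%:E); first by rewrite hE ?(ltW tau0)// lee_fin ltW.
    by rewrite leeDr// gauge_diam_ge0.
  apply: (@le_trans _ _ (g (diam nrm (A n)))); last by rewrite leeDl// lee_fin ltW.
  by rewrite Afin; exact: dnorm_le.
rewrite nneseriesD; [|by move=> n _ _; exact: gauge_diam_ge0|by move=> n _ _; rewrite lee_fin ltW].
apply: (@le_lt_trans _ _ ((C * 2 ^+ d)%:E * (eta%:E + eta%:E))%E).
  rewrite lee_pmul2l ?lte_fin//; apply: leeD; first exact: ltW.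
  exact: (epsilon_trick0 xpredT (ltW eta0)).
rewrite -EFinD -EFinM lte_fin /eta.
have -> : C * 2 ^+ d * (w / (C * 2 ^+ d) / 4 + w / (C * 2 ^+ d) / 4) = w / 2.
  by field; rewrite expf_neq0//= gt_eqF.
by rewrite ltr_pdivrMr// ltr_pMr// ltr1n.
Qed.

Lemma describable_io_ball : describable nrm (nr r) (io_ball nrm x r) U.
Proof.
split.
- split; first by apply: borel_Gdelta; apply: Gdelta_io_ball.
  apply: leb_outerS_eq0 (leb_outer_io_ball d0 hnrm x (fun n => ltW (r_pos n)) r_sum).
  by move=> y [].
- apply/seteqP; split => g /=.
    by move=> [Gg H0]; split => // Gng; exact: hausdorff_neq0 H0.
  by move=> [Gg nG]; split => //; exact: hausdorff_null.
- apply/seteqP; split => g /=; first by move=> [Mg Gg]; exact: Min_Gn.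
  by move=> Gng; split; [exact: Gn_Min|case: Gng].
Qed.

End describable_io_ball.

Unset Implicit Arguments.

Theorem theorem8p7 (R : realType) (d : nat) (hd : (0 < d)%N)
  (nrm : 'rV[R]_d -> R) (hnrm : is_norm nrm)
  (U : set 'rV[R]_d) (hU : open U) (hU0 : U !=set0)
  (x : nat -> 'rV[R]_d) (hx : unif_eutaxic nrm x U)
  (r : nat -> R) (hr_pos : forall n, 0 < r n) (hr_dec : forall n, r n.+1 <= r n) :
  ((\sum_(n <oo) ((r n) ^+ d)%:E)%E = +oo%E ->
     leb_outer (U `\` io_ball nrm x r) = 0%E) /\
  ((\sum_(n <oo) ((r n) ^+ d)%:E < +oo)%E ->
     describable nrm (nr r) (io_ball nrm x r) U).
Proof.
split=> [roo|rfin]; first exact: (full_measure hd hx hr_pos hr_dec roo).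
exact: (describable_io_ball hd hnrm hU hU0 hx hr_pos hr_dec rfin).
Qed.
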